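(* Let $K$ be an algebraically closed field of characteristic $p>0$, let $s\ge 1$ be an integer, and let $n=sp$. Then the $a$-number of the Hurwitz curve $\mathcal{H}_{sp}$ over $K$ is $$a(\mathcal{H}_{sp})=\tfrac14\, s(s+1)p(p-1).$$
   Context: For a positive integer $n$ with $p\nmid n^2-n+1$, the Hurwitz curve $\mathcal{H}_n$ is the nonsingular projective plane curve over $K$ with affine equation $X^nY+Y^n+X=0$ (it has degree $n+1$). For a (projective, irreducible, nonsingular) curve $\mathcal{X}$ over $K$ with separating variable $x$ (i.e. $x\in K(\mathcal{X})\setminus K(\mathcal{X})^p$), every $f\in K(\mathcal{X})$ is uniquely $f=u_0^p+u_1^px+\dots+u_{p-1}^px^{p-1}$ with $u_i\in K(\mathcal{X})$; the Cartier operator is the $1/p$-linear map $\mathcal{C}(f\,dx)=u_{p-1}\,dx$ on differentials (it does not depend on $x$). It maps the $g$-dimensional $K$-space $H^0(\mathcal{X},\Omega^1)$ of holomorphic differentials into itself, where $g$ is the genus. The $a$-number $a(\mathcal{X})$ is the $K$-dimension of the kernel of $\mathcal{C}$ on $H^0(\mathcal{X},\Omega^1)$, equivalently the dimension of the space of exact holomorphic differentials (those of the form $df$, $f\in K(\mathcal{X})$). *)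

(* Defs.v *)
From HB Require Import structures.
From mathcomp Require Import all_boot all_order all_algebra.
From mathcomp Require Import boolp classical_sets.
From mathcomp Require Import mpoly.

Set Implicit Arguments.
Unset Strict Implicit.
Unset Printing Implicit Defensive.

Import GRing.Theory.
Local Open Scope classical_set_scope.
Local Open Scope ring_scope.

(* The function field K(X) of the integral projective plane curve X : G = 0,
   with G a form in K[X, Y, Z].  It is characterized, up to unique isomorphism
   over K, by the homogeneous coordinates ff_coord of the generic point of X
   (e.g. (x : y : 1) with x, y the affine coordinate functions): the forms
   vanishing there are the multiples of G, and rational functions are the
   quotients of forms of the same degree.  Only forms occur in ff_eq0, because
   homogeneous coordinates are not algebraically generic: e.g. Z - 1 vanishes
   at (x, y, 1). *)
Record function_field (K : fieldType) (G : {mpoly K[3]}) := FunctionField {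
  ff_sort :> fieldType;
  ff_const : {rmorphism K -> ff_sort};
  ff_coord : 'I_3 -> ff_sort;
  ff_eq0 : forall (k : nat) (a : {mpoly K[3]}), a \is k.-homog ->
    mmap ff_const ff_coord a = 0 <-> exists b : {mpoly K[3]}, a = b * G;
  ff_quotient : forall f : ff_sort, exists (k : nat) (a b : {mpoly K[3]}),
    [/\ a \is k.-homog, b \is k.-homog, mmap ff_const ff_coord b != 0
      & f = mmap ff_const ff_coord a / mmap ff_const ff_coord b] }.

Definition derivation (K F : fieldType) (iota : {rmorphism K -> F})
    (M : lmodType F) (D : F -> M) : Prop :=
  [/\ forall f g : F, D (f + g) = D f + D g,
      forall f g : F, D (f * g) = f *: D g + g *: D f
    & forall c : K, D (iota c) = 0].

(* The module of Kaehler differentials of F over K (embedded in F by iota),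
   given by its universal derivation. *)
Record differentials (K F : fieldType) (iota : {rmorphism K -> F}) :=
  Differentials {
  diff_sort :> lmodType F;
  diff : F -> diff_sort;
  diff_derivation : derivation iota diff;
  diff_universal : forall (M : lmodType F) (D : F -> M), derivation iota D ->
    exists2 phi : {linear diff_sort -> M},
      (forall f : F, phi (diff f) = D f)
    & forall psi : {linear diff_sort -> M},
        (forall f : F, psi (diff f) = D f) -> psi =1 phi }.

Definition has_dim (K F : fieldType) (iota : {rmorphism K -> F})
    (M : lmodType F) (S : set M) (m : nat) : Prop :=
  exists b : 'I_m -> M,
    (forall c : 'I_m -> K,
       \sum_i iota (c i) *: b i = 0 -> forall i, c i = 0) /\
    (forall w : M, S w <-> exists c : 'I_m -> K, w = \sum_i iota (c i) *: b i).

(* The dimension over K of a K-subspace S of an F-module; it is 0 by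
   convention if S is not a finite-dimensional K-subspace. *)
Definition dimK (K F : fieldType) (iota : {rmorphism K -> F})
    (M : lmodType F) (S : set M) : nat :=
  xget 0%N [set m | has_dim iota S m].

Definition separating (F : fieldType) (p : nat) (x : F) : Prop :=
  ~ exists z : F, x = z ^+ p.

(* C((u_0^p + u_1^p x + ... + u_(p-1)^p x^(p-1)) dx) = u_(p-1) dx; for F a
   function field of one variable over a perfect field of characteristic p,
   every w has such an expression for each separating x, and the value
   u_(p-1) dx depends neither on the expression nor on x. *)
Definition cartier (p : nat) (K F : fieldType) (iota : {rmorphism K -> F})
    (W : differentials iota) (w : W) : W :=
  xget 0 [set v | exists (x : F) (u : nat -> F),
    [/\ separating p x,
        w = (\sum_(i < p) u i ^+ p * x ^+ i) *: diff W x
      & v = u p.-1 *: diff W x]].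

(* P is a representative of the point (P 0 : P 1 : P 2) of the projective
   plane. *)
Definition on_curve (K : fieldType) (G : {mpoly K[3]}) (P : 'I_3 -> K) : Prop :=
  (exists i, P i != 0) /\ G.@[P] = 0.

Section PlaneCurve.
Variables (K : fieldType) (G : {mpoly K[3]}) (X : function_field G).

Definition regular_at (P : 'I_3 -> K) (f : X) : Prop :=
  exists (k : nat) (a b : {mpoly K[3]}),
    [/\ a \is k.-homog, b \is k.-homog, b.@[P] != 0
      & f = mmap (ff_const X) (ff_coord X) a
            / mmap (ff_const X) (ff_coord X) b].

Variable W : differentials (ff_const X).

(* w is regular at P if it lies in the stalk at P of the sheaf of
   differentials, that is, in the O_P-submodule of W generated by d(O_P). *)
Definition regular_diff_at (P : 'I_3 -> K) (w : W) : Prop :=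
  exists (m : nat) (f g : 'I_m -> X),
    [/\ forall i, regular_at P (f i), forall i, regular_at P (g i)
      & w = \sum_i f i *: diff W (g i)].

(* The space H^0(X, Omega^1), for X nonsingular. *)
Definition holomorphic (w : W) : Prop :=
  forall P : 'I_3 -> K, on_curve G P -> regular_diff_at P w.

Definition a_number (p : nat) : nat :=
  dimK (ff_const X) [set w : W | holomorphic w /\ cartier p w = 0].

End PlaneCurve.

(* X^n Y + Y^n Z + Z^n X, the homogenization of X^n Y + Y^n + X. *)
Definition hurwitz (K : fieldType) (n : nat) : {mpoly K[3]} :=
  let X := 'X_(inord 0) in let Y := 'X_(inord 1) in let Z := 'X_(inord 2) in
  X ^+ n * Y + Y ^+ n * Z + Z ^+ n * X.

(* Main.v *)
(* Proof idea.  With x = X/Z and y = Y/Z the curve is x = -(x^n y + y^n), and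
   p | n makes dx = -x^n dy, so that dy generates the differentials off the
   line Z = 0 and H^0(Omega^1) is the space of all h(x, y) dy with h of degree
   at most n - 2.  Here x is y times a p-th power plus a p-th power, so
   C(x^i y^j dy) is either 0 or a nonzero multiple of some x^a y^b dy; writing
   i0 and j0 for the residues of i and j modulo p, it vanishes exactly for
   i0 + j0 < p - 1, and otherwise (a, b) determines (i, j) and a + b <= n - 2.
   Hence the kernel of C is spanned by the x^i y^j dy with i + j <= n - 2 and
   i0 + j0 <= p - 2: with n = sp these are the i = p i1 + i0, j = p j1 + j0 such
   that i1 + j1 <= s - 1 and i0 + j0 <= p - 2.

   The Cartier operator is handled through the derivation D = d/dy: the field
   is free over its p-th powers on 1, y, ..., y^(p-1), and f dy is killed by C
   iff D^(p-1) f = 0, whichever separating element is used in C.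

   A section of O(m) on the curve is a form of degree m: being regular on the
   affine part it has a denominator q(x), whose roots are removed one at a time
   by comparing multiplicities on the lines x = a; regularity at the two points
   of Z = 0 then lowers the degree down to m. *)

Require Import Defs.
From HB Require Import structures.
From mathcomp Require Import all_boot all_order all_algebra.
From mathcomp Require Import ring.
From mathcomp Require Import boolp.
From mathcomp Require classical_sets.
From mathcomp Require Import mpoly.
Set Implicit Arguments.
Unset Strict Implicit.
Unset Printing Implicit Defensive.
Import GRing.Theory.
Local Open Scope ring_scope.

(** * Derivations in characteristic p *)

(** In characteristic p the additive and Leibniz rules kill p-th powers, hence all constants of an
    algebraically closed field; [iter p D] and D / D x fall under this notion as well. *)
Definition derivative (F : fieldType) (M : lmodType F) (d : F -> M) : Prop :=
  (forall f g, d (f + g) = d f + d g) /\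
  (forall f g, d (f * g) = f *: d g + g *: d f).

Section Derivative.
Variables (F : fieldType) (M : lmodType F) (d : F -> M) (dd : derivative d).

Lemma derivativeD f g : d (f + g) = d f + d g.
Proof. by case: dd. Qed.

Lemma derivativeM f g : d (f * g) = f *: d g + g *: d f.
Proof. by case: dd. Qed.

Lemma derivative0 : d 0 = 0.
Proof. by apply: (addIr (d 0)); rewrite -derivativeD !add0r. Qed.

Lemma derivative1 : d 1 = 0.
Proof.
apply: (addIr (d 1)); rewrite add0r -[in RHS](mulr1 1) derivativeM.
by rewrite scale1r.
Qed.

Lemma derivativeN f : d (- f) = - d f.
Proof.
by apply: (addIr (d f)); rewrite -derivativeD !addNr derivative0.
Qed.

Lemma derivative_sum (I : Type) (r : seq I) (P : pred I) (E : I -> F) :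
  d (\sum_(i <- r | P i) E i) = \sum_(i <- r | P i) d (E i).
Proof. exact: (big_morph d derivativeD derivative0). Qed.

Lemma derivativeX f k : d (f ^+ k) = (f ^+ k.-1 *+ k) *: d f.
Proof.
elim: k => [|k IHk]; first by rewrite expr0 derivative1 mulr0n scale0r.
rewrite exprS derivativeM IHk scalerA -scalerDl /=; congr (_ *: _).
by case: k {IHk} => [|k]; rewrite ?mulr0n ?mulr0 ?add0r // mulrnAr -exprS -mulrSr.
Qed.

Lemma derivativeV f : f != 0 -> d f^-1 = - f ^- 2 *: d f.
Proof.
move=> f0; have := derivative1; rewrite -(mulfV f0) derivativeM => /eqP.
rewrite addr_eq0 => /eqP /(congr1 (fun v => f^-1 *: v)).
rewrite scalerA mulVf // scale1r => ->; rewrite scalerN scalerA scaleNr.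
by rewrite expr2 invfM.
Qed.

Variables (p : nat) (hp : p \in [pchar F]).

Lemma derivative_pth f : d (f ^+ p) = 0.
Proof. by rewrite derivativeX -mulr_natr pcharf0 // mulr0 scale0r. Qed.

Lemma derivative_pthM v f : d (v ^+ p * f) = v ^+ p *: d f.
Proof. by rewrite derivativeM derivative_pth scaler0 addr0. Qed.

End Derivative.

Section IteratedDerivative.
Variables (F : fieldType) (D : F -> F) (dD : derivative (D : F -> F^o)).

Let DD f g : D (f + g) = D f + D g. Proof. exact: (derivativeD dD). Qed.

Let DM f g : D (f * g) = f * D g + g * D f.
Proof. exact: (derivativeM dD). Qed.

Lemma iter_derivativeD k f g : iter k D (f + g) = iter k D f + iter k D g.
Proof. by elim: k => //= k ->. Qed.

Lemma iter_derivative0 k : iter k D 0 = 0.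
Proof. by elim: k => //= k ->; exact: (derivative0 dD). Qed.

Lemma iter_derivative_sum k (I : Type) (r : seq I) (P : pred I) (E : I -> F) :
  iter k D (\sum_(i <- r | P i) E i) = \sum_(i <- r | P i) iter k D (E i).
Proof.
exact: (big_morph _ (iter_derivativeD k) (iter_derivative0 k)).
Qed.

Lemma iter_derivativeMconst k c f :
  D c = 0 -> iter k D (c * f) = c * iter k D f.
Proof. by move=> Dc; elim: k => //= k ->; rewrite DM Dc mulr0 addr0. Qed.

Lemma iter_derivativeM k f g :
  iter k D (f * g) =
  \sum_(i < k.+1) (iter (k - i) D f * iter i D g) *+ 'C(k, i).
Proof.
elim: k => [|k IHk]; first by rewrite big_ord1.
have Dn a m : D (a *+ m) = D a *+ m.
  elim: m => [|m IHm]; first exact: (derivative0 dD).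
  by rewrite !mulrS DD IHm.
rewrite iterS IHk (derivative_sum dD) /=.
under eq_bigr => i _ do rewrite Dn DM mulrnDl.
rewrite big_split /= big_ord_recr /= [X in X + _ + _]/=.
rewrite [in X in _ + X]big_ord_recl /= [RHS]big_ord_recl [in RHS]big_ord_recr /=.
rewrite !subnn !subn0 !bin0 !binn !mulr1n /=.
have -> a b c e : a + b + (c + e) = c + (a + e + b) :> F.
  by rewrite addrCA -!addrA; congr (_ + (_ + _)); rewrite addrC.
congr (_ + (_ + _)); first by rewrite mulrC.
rewrite -big_split /=; apply: eq_bigr => i _.
rewrite /bump /= !add1n subSS binS mulrnDr addrC; congr (_ *+ _ + _ *+ _).
by rewrite mulrC -iterS subnSK.
Qed.

Variables (p : nat) (hp : p \in [pchar F]).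

(** The inner binomial coefficients in the Leibniz formula for the p-th iterate are divisible by p,
    so only its two extreme terms survive. *)
Lemma iter_derivative_pchar : derivative (iter p D : F -> F^o).
Proof.
split=> [f g|f g]; first exact: iter_derivativeD.
have := @bin_lt_pcharf_0 _ _ hp; have := prime_gt0 (pcharf_prime hp).
rewrite iter_derivativeM; case: (p) => // m _ bin0p.
rewrite big_ord_recr /= big_ord_recl /= big1 => [|i _]; last first.
  by rewrite -mulr_natr bin0p ?mulr0 // /bump /= add1n ltnS.
rewrite addr0 bin0 binn subnn !mulr1n /= addrC.
by congr (_ + _); exact: mulrC.
Qed.

Lemma iter_derivative_pthM k v f :
  iter k D (v ^+ p * f) = v ^+ p * iter k D f.
Proof. by apply: iter_derivativeMconst => //; exact: (derivative_pth dD hp). Qed.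

Lemma iter_derivative_X y k i :
  D y = 1 -> iter k D (y ^+ i) = y ^+ (i - k) *+ i ^_ k.
Proof.
move=> Dy; elim: k => [|k IHk]; first by rewrite subn0 ffactn0.
have Dn a m : D (a *+ m) = D a *+ m.
  elim: m => [|m IHm]; first exact: (derivative0 dD).
  by rewrite !mulrS DD IHm.
rewrite iterS IHk Dn (derivativeX dD) Dy ffactnSr [_ *: (1 : F^o)]mulr1.
by rewrite -mulrnA mulnC subnS.
Qed.

(** The coefficients are constants for D, and p - 1 derivations kill y^i for i < p - 1 and send
    y^(p-1) to (p-1)!. This reads off the coefficient that defines the Cartier operator. *)
Lemma iter_derivative_pred y (u : nat -> F) : D y = 1 ->
  iter p.-1 D (\sum_(i < p) u i ^+ p * y ^+ i) = u p.-1 ^+ p * (p.-1)`!%:R.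
Proof.
move=> Dy; rewrite iter_derivative_sum.
case: (p) (prime_gt0 (pcharf_prime hp)) iter_derivative_pthM => // m _ DpM.
rewrite big_ord_recr big1 /= => [|i _].
  by rewrite add0r DpM iter_derivative_X // subnn ffactnn expr0.
by rewrite DpM iter_derivative_X // ffact_small // mulr0n mulr0.
Qed.

Lemma derivative_natr k : D k%:R = 0.
Proof.
elim: k => [|k IHk]; first exact: (derivative0 dD).
by rewrite mulrSr DD IHk (derivative1 dD) addr0.
Qed.

End IteratedDerivative.

(** * Fields spanned over their p-th powers by the powers of one element *)

Section PBasis.
Variables (F : fieldType) (p : nat) (hp : p \in [pchar F]).
Variable y : F.
Hypothesis pbasis :
  forall f, exists u : nat -> F, f = \sum_(i < p) u i ^+ p * y ^+ i.
Variable D : F -> F.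
Hypotheses (dD : derivative (D : F -> F^o)) (Dy : D y = 1).

Let p_gt0 : (0 < p)%N. Proof. exact: prime_gt0 (pcharf_prime hp). Qed.

Let natr_neq0 k : (0 < k < p)%N -> k%:R != 0 :> F.
Proof.
by case/andP=> k0 kp; rewrite -(dvdn_pcharf hp) gtnNdvd.
Qed.

Let natr_pth k : k%:R ^+ p = k%:R :> F.
Proof. exact: (pFrobenius_aut_nat hp). Qed.

Lemma DpthM v f : D (v ^+ p * f) = v ^+ p * D f.
Proof. exact: (derivative_pthM dD hp). Qed.

(** Any such map is linear over p-th powers, so on the expansion in powers of y it is determined by
    its value at y. *)
Lemma derivative_pbasis (M : lmodType F) (d : F -> M) :
  derivative d -> forall f, d f = D f *: d y.
Proof.
move=> dd f; have [u ->] := pbasis f.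
rewrite (derivative_sum dd) (derivative_sum dD) scaler_suml.
apply: eq_bigr => i _; rewrite (derivative_pthM dd hp) DpthM -scalerA.
rewrite (derivativeX dd) (derivativeX dD) Dy; congr (_ *: _).
by rewrite [_ *: (1 : F^o)]mulr1.
Qed.

Lemma iterDp f : iter p D f = 0.
Proof.
have [u ->] := pbasis f; rewrite (iter_derivative_sum dD) big1 // => i _.
rewrite (iter_derivative_pthM dD hp) (iter_derivative_X dD _ _ Dy).
by rewrite ffact_small // mulr0n mulr0.
Qed.

Lemma fact_neq0 k : (k < p)%N -> k`!%:R != 0 :> F.
Proof.
elim: k => [|k IHk] kp; first by rewrite oner_eq0.
by rewrite factS natrM; apply: mulf_neq0; [exact: natr_neq0 | exact/IHk/ltnW].
Qed.

(** As (p-1)! is invertible, the coefficient of y^(p-1) vanishes; the other powers of y have the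
    primitives y^(i+1) / (i+1), with i + 1 < p. *)
Lemma iterDp1_eq0 f : iter p.-1 D f = 0 -> exists g, f = D g.
Proof.
have [u ->] := pbasis f; rewrite (iter_derivative_pred dD hp _ Dy) => /eqP.
rewrite mulf_eq0 (negPf (fact_neq0 _)) ?prednK // orbF expf_eq0 p_gt0 /=.
move=> /eqP up.
exists (\sum_(i < p.-1) u i ^+ p * (i.+1%:R^-1 * y ^+ i.+1)).
rewrite (derivative_sum dD) /=; case: (p) p_gt0 up natr_neq0 DpthM => // m _.
move=> um mn0 DM; rewrite big_ord_recr /= um expr0n /= mul0r addr0.
apply: eq_bigr => i _; rewrite DM; congr (_ * _).
have i0 : i.+1%:R != 0 :> F by apply: mn0; rewrite /= ltnS.
have -> : D (i.+1%:R^-1 * y ^+ i.+1) = i.+1%:R^-1 * D (y ^+ i.+1).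
  rewrite (derivativeM dD) (derivativeV dD) // (derivative_natr dD).
  by rewrite scaler0 scaler0 addr0.
by rewrite (derivativeX dD) Dy [_ *: (1 : F^o)]mulr1 -[y ^+ _ *+ _]mulr_natl mulKf.
Qed.

(** Shows that separating elements have non-zero derivative. Applying D to the expansion of f,
    independence of the powers of y leaves only the term of index 0. *)
Lemma D_eq0 f : D f = 0 -> exists z, f = z ^+ p.
Proof.
have [u ->] := pbasis f.
(* Independence of 1, y, ..., y^(m-1) over the p-th powers, by induction on m: differentiating
   shortens a relation, and the factors i + 1 are absorbed in the coefficients because (i+1)^p = i +
   1. *)
suff H m (v : nat -> F) : (m <= p)%N ->
    \sum_(i < m) v i ^+ p * y ^+ i = 0 -> forall i, (i < m)%N -> v i = 0.
  rewrite (derivative_sum dD) => Du0; exists (u 0%N).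
  have u0 i : (i < p.-1)%N -> u i.+1 * i.+1%:R = 0.
    move: i; apply: (H _ (fun i => u i.+1 * i.+1%:R)); first exact: leq_pred.
    rewrite -[RHS]Du0; case: (p) p_gt0 natr_pth DpthM => // m _.
    move=> fn DM; rewrite [RHS]big_ord_recl DM expr0 (derivative1 dD) mulr0 add0r.
    apply: eq_bigr => i _; rewrite DM (derivativeX dD) Dy [_ *: (1 : F^o)]mulr1.
    by rewrite exprMn fn -mulrA mulr_natl.
  case: (p) p_gt0 u0 natr_neq0 => // m _ u0 mn0.
  rewrite big_ord_recl expr0 mulr1 big1 ?addr0 // => i _.
  have /eqP := u0 i (ltn_ord i); rewrite mulf_eq0 (negPf (mn0 _ _)) ?ltnS //=.
  by rewrite orbF /bump add1n => /eqP ->; rewrite expr0n mul0r.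
elim: m v => // m IHm v mp v0.
have v0' i : (i < m)%N -> v i.+1 * i.+1%:R = 0.
  move: i; apply: (IHm (fun i => v i.+1 * i.+1%:R)); first exact: ltnW.
  rewrite -[RHS](derivative0 dD) -[in RHS]v0.
  rewrite (derivative_sum dD) [RHS]big_ord_recl DpthM expr0 (derivative1 dD).
  rewrite mulr0 add0r. apply: eq_bigr => i _.
  rewrite DpthM (derivativeX dD) Dy [_ *: (1 : F^o)]mulr1 exprMn.
  by rewrite natr_pth -mulrA mulr_natl.
have vS i : (i < m)%N -> v i.+1 = 0.
  move=> im; have /eqP := v0' i im; rewrite mulf_eq0 (negPf (natr_neq0 _)).
    by rewrite orbF => /eqP.
  by rewrite /= (leq_trans _ mp).
case=> [_|i]; last by rewrite ltnS; exact: vS.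
move: v0; rewrite big_ord_recl expr0 mulr1 big1 => [/eqP|i _].
  by rewrite addr0 expf_eq0 p_gt0 => /eqP.
by rewrite /= /bump /= add1n vS // expr0n gtn_eqF // mul0r.
Qed.

(* With d/dx = (D x)^-1 D, the operator (d/dx)^p is again a derivation, and it
   kills x, hence vanishes; so x^(p-1) is not of the form dg/dx. *)
Lemma iterDp1_rep x (u : nat -> F) : D x != 0 ->
  iter p.-1 D ((\sum_(i < p) u i ^+ p * x ^+ i) * D x) = 0 <-> u p.-1 = 0.
Proof.
move=> Dx0; pose E g := (D x)^-1 * D g.
have dE : derivative (E : F -> F^o).
  split=> f g; first by rewrite /E (derivativeD dD) mulrDr.
  have DM : D (f * g) = f * D g + g * D f := derivativeM dD f g.
  by rewrite /E DM mulrDr mulrCA [_ * (g * _)]mulrCA.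
have Ex : E x = 1 by rewrite /E mulVf.
have Epth v f : E (v ^+ p * f) = v ^+ p * E f.
  by rewrite /E DpthM mulrCA.
have Ep0 g : iter p E g = 0.
  have Ed := iter_derivative_pchar dE hp.
  have Eg h : iter p E h = D h * iter p E y := derivative_pbasis Ed h.
  rewrite Eg.
  have /eqP : iter p E x = 0.
    rewrite -[x]expr1 (iter_derivative_X dE) // ffact_small ?mulr0n //.
    exact: prime_gt1 (pcharf_prime hp).
  by rewrite Eg mulf_eq0 (negPf Dx0) => /eqP ->; rewrite mulr0.
split=> [/iterDp1_eq0 [g /(congr1 (fun h => (D x)^-1 * h))]|up].
  rewrite mulrC mulfK // => Eg; have := Ep0 g.
  rewrite -[X in iter X](prednK p_gt0) iterSr -[E g]Eg.
  rewrite (iter_derivative_pred dE hp _ Ex) => /eqP.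
  rewrite mulf_eq0 (negPf (fact_neq0 _)) ?prednK // orbF expf_eq0 p_gt0 /=.
  by move=> /eqP.
rewrite mulr_suml (iter_derivative_sum dD) big1 // => i _.
have [->|ip] := eqVneq (i : nat) p.-1.
  by rewrite up expr0n gtn_eqF // !mul0r (iter_derivative0 dD).
rewrite -mulrA (iter_derivative_pthM dD hp).
(* For i other than p - 1 the term has a primitive, so its (p-1)-st derivative is a p-th derivative,
   which vanishes. *)
suff -> : x ^+ i * D x = D (i.+1%:R^-1 * x ^+ i.+1).
  by rewrite -iterSr prednK // iterDp mulr0.
have i0 : i.+1%:R != 0 :> F.
  by apply: natr_neq0; rewrite /= -ltn_predRL ltn_neqAle ip -ltnS prednK /=.
have Dc : D i.+1%:R^-1 = 0.
  by rewrite (derivativeV dD) // (derivative_natr dD) scaler0.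
have DX : D (x ^+ i.+1) = x ^+ i *+ i.+1 * D x := derivativeX dD x i.+1.
rewrite (derivativeM dD) Dc scaler0 addr0 DX -[x ^+ i *+ _]mulr_natl -mulrA.
exact/esym/(mulKf i0).
Qed.

End PBasis.

(** * The affine curve and its function field *)

Lemma closed_pth_root (K : closedFieldType) (p : nat) (c : K) :
  (0 < p)%N -> exists z, c = z ^+ p.
Proof.
move=> p0; have [z zE] := solve_monicpoly (fun i => if i == 0%N then c else 0) p0.
exists z; rewrite zE; case: p p0 {zE} => // p _.
by rewrite big_ord_recl expr0 mulr1 big1 ?addr0 // => i _; rewrite mul0r.
Qed.

(** * Extension of a derivation to a field of fractions *)

Section ExtendDerivation.
Variables (R : comNzRingType) (F : fieldType) (ev : {rmorphism R -> F}).
Variable delta : R -> R.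
Hypothesis deltaD : forall a b, delta (a + b) = delta a + delta b.
Hypothesis deltaM : forall a b, delta (a * b) = a * delta b + b * delta a.
Hypothesis delta_ker : forall a, ev a = 0 -> ev (delta a) = 0.
Hypothesis ev_frac : forall f, exists a b, ev b != 0 /\ f = ev a / ev b.

(** [q] is the quotient rule (da - f db) / b for f = a / b. Two fractions a / b = c / d give the
    same value because [delta] preserves the kernel of [ev], which contains a d - c b. *)
Lemma extend_derivation : exists D : F -> F,
  derivative (D : F -> F^o) /\ forall a, D (ev a) = ev (delta a).
Proof.
pose q f ab := (ev (delta ab.1) - f * ev (delta ab.2)) / ev ab.2.
have /choice[s sP] f :
    exists ab : R * R, ev ab.2 != 0 /\ f = ev ab.1 / ev ab.2.
  by have [a [b ab]] := ev_frac f; exists (a, b).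
have delta0 : delta 0 = 0 by apply: (addIr (delta 0)); rewrite -deltaD !add0r.
have deltaN a : delta (- a) = - delta a.
  by apply: (addIr (delta a)); rewrite -deltaD !addNr.
have qE f a b : ev b != 0 -> f = ev a / ev b -> q f (s f) = q f (a, b).
  have [] := sP f; case: (s f) => c d /= d0 fE b0 fE'.
  have cE : ev c = f * ev d by rewrite fE divfK.
  have aE : ev a = f * ev b by rewrite fE' divfK.
  have /delta_ker : ev (a * d - c * b) = 0.
    by rewrite rmorphB !rmorphM cE aE; ring.
  rewrite deltaD deltaN !deltaM !rmorphD rmorphN rmorphD !rmorphM cE aE => H.
  apply/eqP; rewrite /q /= eqr_div // -subr_eq0 -oppr_eq0; apply/eqP.
  by rewrite -[RHS]H; ring.
pose D f := q f (s f); exists D; split; last first.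
  move=> a; have := qE (ev a) a 1; rewrite rmorph1 divr1 oner_eq0 /D => -> //.
  have d1 : delta 1 = 0.
    by apply: (addIr (delta 1)); rewrite add0r -[in RHS](mulr1 1) deltaM !mul1r.
  by rewrite /q /= d1 rmorph0 rmorph1 mulr0 subr0 divr1.
split=> f g.
  have [] := sP f; have [] := sP g.
  rewrite [D f]/(q f (s f)) [D g]/(q g (s g)).
  case: (s f) (s g) => [a b] [c d] /= d0 gE b0 fE.
  rewrite /D (qE _ (a * d + c * b) (b * d)).
  - rewrite /q /= deltaD !deltaM !rmorphD !rmorphM /= gE fE; field.
    by rewrite b0 d0.
  - by rewrite rmorphM mulf_neq0.
  - by rewrite rmorphD !rmorphM gE fE; field; rewrite b0 d0.
suff: D (f * g) = f * D g + g * D f by [].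
have [] := sP f; have [] := sP g.
rewrite [D f]/(q f (s f)) [D g]/(q g (s g)).
case: (s f) (s g) => [a b] [c d] /= d0 gE b0 fE.
rewrite /D (qE _ (a * c) (b * d)).
- rewrite /q /= !deltaM !rmorphD !rmorphM /= gE fE.
  by field; rewrite b0 d0.
- by rewrite rmorphM mulf_neq0.
- by rewrite !rmorphM gE fE; field; rewrite b0 d0.
Qed.

End ExtendDerivation.

(** Serves both for the generic point, with values in the function field, and, with [idfun], for
    points over K. *)
Definition biev (K L : nzRingType) (kappa : {rmorphism K -> L}) (x y : L)
  (A : {poly {poly K}}) : L :=
  (map_poly (fun q => (map_poly kappa q).[x]) A).[y].

Section Biev.
Variables (K L : fieldType) (kappa : {rmorphism K -> L}) (x y : L).

Let biev_comp : {rmorphism {poly {poly K}} -> L} :=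
  horner_eval y \o map_poly (horner_eval x \o map_poly kappa).

Lemma biev_is_zmod_morphism : zmod_morphism (biev kappa x y).
Proof. exact: (raddfB biev_comp). Qed.

Lemma biev_is_monoid_morphism : monoid_morphism (biev kappa x y).
Proof. by split; [exact: (rmorph1 biev_comp)|exact: (rmorphM biev_comp)]. Qed.

HB.instance Definition _ := GRing.isZmodMorphism.Build {poly {poly K}} L
  (biev kappa x y) biev_is_zmod_morphism.
HB.instance Definition _ := GRing.isMonoidMorphism.Build {poly {poly K}} L
  (biev kappa x y) biev_is_monoid_morphism.

Lemma bievB : {morph biev kappa x y : A B / A - B}.
Proof. exact: rmorphB. Qed.

Lemma bievN : {morph biev kappa x y : A / - A}.
Proof. exact: rmorphN. Qed.

Lemma bievM : {morph biev kappa x y : A B / A * B}.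
Proof. exact: rmorphM. Qed.

Lemma bievX : biev kappa x y 'X = y.
Proof.
have -> : biev kappa x y 'X = biev_comp 'X by [].
by rewrite /= map_polyX /horner_eval hornerX.
Qed.

Lemma bievC q : biev kappa x y q%:P = (map_poly kappa q).[x].
Proof.
have -> : biev kappa x y q%:P = biev_comp q%:P by [].
by rewrite /= map_polyC /= /horner_eval hornerC.
Qed.

Lemma bievCX : biev kappa x y 'X%:P = x.
Proof. by rewrite bievC map_polyX hornerX. Qed.

Lemma bievCC c : biev kappa x y c%:P%:P = kappa c.
Proof. by rewrite bievC map_polyC hornerC. Qed.

End Biev.

Section Hurwitz.
Variables (K : fieldType) (n : nat).

(* The affine equation in every chart, by cyclic symmetry; the outer variable
   is y, so that haff is monic. *)
Definition haff : {poly {poly K}} := 'X ^+ n + ('X ^+ n)%:P * 'X + 'X%:P.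

Lemma biev_haff (L : fieldType) (kappa : {rmorphism K -> L}) (x y : L) :
  biev kappa x y haff = y ^+ n + x ^+ n * y + x.
Proof. by rewrite !rmorphD rmorphM !rmorphXn /= bievX !bievCX. Qed.

(* The derivation d/dy of the function field, for which dx/dy = -x^n. *)
Definition hder (A : {poly {poly K}}) : {poly {poly K}} :=
  A^`() - ('X ^+ n)%:P * map_poly (@deriv K) A.

Lemma hderD A B : hder (A + B) = hder A + hder B.
Proof. by rewrite /hder derivD raddfD mulrDr opprD addrACA. Qed.

Lemma map_derivM (A B : {poly {poly K}}) : map_poly (@deriv K) (A * B) =
  A * map_poly (@deriv K) B + B * map_poly (@deriv K) A.
Proof.
apply/polyP => k; rewrite coef_map coefD /= [B * _]mulrC !coefM raddf_sum.
rewrite -big_split /=; apply: eq_bigr => i _.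
by rewrite derivM !coef_map addrC.
Qed.

Lemma hderM A B : hder (A * B) = A * hder B + B * hder A.
Proof. by rewrite /hder derivM map_derivM; ring. Qed.

(** When n = 0 in K the n-th powers are constants, and the terms x^n y and x contribute x^n and
    -x^n. *)
Lemma hder_haff : n%:R = 0 :> K -> hder haff = 0.
Proof.
move=> n0.
have n0P : n%:R = 0 :> {poly K} by rewrite -polyC_natr n0.
have n0PP : n%:R = 0 :> {poly {poly K}} by rewrite -polyC_natr n0P.
have dXn k : map_poly (@deriv K) ('X ^+ k) = 0.
  apply/polyP => i; rewrite coef_map coefXn coef0 /=.
  by case: eqP => _; rewrite ?derivC ?raddf0.
have dC q : map_poly (@deriv K) q%:P = (q^`())%:P.
  by apply/polyP => i; rewrite coef_map !coefC /=; case: eqP => _; rewrite ?raddf0.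
rewrite /hder /haff !derivD derivM derivX !derivC derivXn -mulr_natr n0PP.
rewrite !raddfD /= map_derivM dXn !dC derivX derivXn -mulr_natr n0P.
have -> : map_poly (@deriv K) 'X = 0 by rewrite -['X]expr1 dXn.
by rewrite !(mulr0, mul0r, add0r, addr0, mulr1) subrr.
Qed.

Lemma hder_ker (L : fieldType) (kappa : {rmorphism K -> L}) (x y : L) B :
  n%:R = 0 :> K -> biev kappa x y haff = 0 ->
  biev kappa x y (hder (B * haff)) = 0.
Proof.
by move=> n0 h0; rewrite hderM hder_haff // mulr0 add0r rmorphM /= h0 mul0r.
Qed.

End Hurwitz.

(* x and y generate a function field L over K with ideal of relations (haff). *)
Definition chart (K L : fieldType) (n : nat) (kappa : {rmorphism K -> L})
    (x y : L) : Prop :=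
  (forall A, biev kappa x y A = 0 <-> exists B, A = B * haff K n) /\
  (forall f, exists A B,
     biev kappa x y B != 0 /\ f = biev kappa x y A / biev kappa x y B).

Section Chart.
Variables (K L : fieldType) (n : nat) (kappa : {rmorphism K -> L}) (x y : L).
Hypothesis xy : chart n kappa x y.

Lemma chart_haff : biev kappa x y (haff K n) = 0.
Proof. by case: xy => ker _; apply/ker; exists 1; rewrite mul1r. Qed.

Lemma chart_eq : y ^+ n + x ^+ n * y + x = 0.
Proof. by rewrite -(biev_haff _ kappa) chart_haff. Qed.

Lemma chart_derivation : n%:R = 0 :> K -> exists D : L -> L,
  [/\ derivative (D : L -> L^o), D y = 1 &
    forall A, D (biev kappa x y A) = biev kappa x y (hder n A)].
Proof.
move=> n0; have [ker fr] := xy.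
have dker A : biev kappa x y A = 0 -> biev kappa x y (hder n A) = 0.
  by move=> /ker[B ->]; rewrite hder_ker // chart_haff.
have [D [dD DE]] := extend_derivation (@hderD K n) (@hderM K n) dker fr.
exists D; split=> //; rewrite -[y in D y](bievX kappa x y) DE /hder derivX.
have -> : map_poly (@deriv K) 'X = 0.
  apply/polyP => i; rewrite coef_map coefX coef0 /=.
  by case: eqP => _; rewrite ?derivC ?raddf0.
by rewrite mulr0 subr0 rmorph1.
Qed.

End Chart.

Section ChartPchar.
Variables (K : closedFieldType) (L : fieldType) (p s : nat).
Hypothesis hp : p \in [pchar K].
Variables (kappa : {rmorphism K -> L}) (x y : L).
Hypothesis xy : chart (s * p) kappa x y.

Let hpL : p \in [pchar L]. Proof. by rewrite (fmorph_pchar kappa). Qed.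

Let p_gt0 : (0 < p)%N. Proof. exact: prime_gt0 (pcharf_prime hp). Qed.

(** The image of [Phi] is the ring generated by y over the p-th powers of L. It contains the
    constants and x, and is closed under quotients, so it is L; y^p is itself a p-th power, so the
    exponents below p suffice. *)
Lemma chart_pbasis f :
  exists u : nat -> L, f = \sum_(i < p) u i ^+ p * y ^+ i.
Proof.
have [Phi PhiX PhiC] : exists2 Phi : {rmorphism {poly L} -> L},
    Phi 'X = y & forall c, Phi c%:P = c ^+ p.
  exists (horner_eval y \o map_poly (pFrobenius_aut hpL)) => [|c] /=.
    by rewrite map_polyX /horner_eval hornerX.
  by rewrite map_polyC /horner_eval hornerC.
have PhiK c : exists P, kappa c = Phi P.
  have [z ->] := closed_pth_root c p_gt0.
  by exists (kappa z)%:P; rewrite PhiC rmorphXn.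
have Phix : exists P, x = Phi P.
  (* As n = sp, the equation of the curve reads x = -((y^s)^p + (x^s)^p y). *)
  exists (- ((y ^+ s)%:P + (x ^+ s)%:P * 'X)).
  rewrite rmorphN rmorphD rmorphM !PhiC PhiX -!exprM; apply/eqP.
  by rewrite -subr_eq0 opprK addrC (chart_eq xy).
have PhiA A : exists P, biev kappa x y A = Phi P.
  elim/poly_ind: A => [|A q [P AP]]; first by exists 0; rewrite !rmorph0.
  suff [Q qQ] : exists Q, biev kappa x y q%:P = Phi Q.
    by exists (P * 'X + Q); rewrite !rmorphD !rmorphM /= bievX PhiX AP qQ.
  elim/poly_ind: q => [|q c [Q qQ]]; first by exists 0; rewrite !rmorph0.
  have [[X XE] [C cC]] := (Phix, PhiK c).
  exists (Q * X + C); rewrite polyCD polyCM !rmorphD !rmorphM /= bievCC bievCX.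
  by rewrite qQ cC -XE.
have [P ->] : exists P, f = Phi P.
  have [A [B [B0 ->]]] := xy.2 f; have [[P ->] [Q QE]] := (PhiA A, PhiA B).
  (* A / B = A B^(p-1) (1/B)^p, and (1/B)^p is the image of a constant polynomial. *)
  rewrite QE in B0 *; exists (P * Q ^+ p.-1 * (Phi Q)^-1%:P).
  rewrite !rmorphM PhiC rmorphXn -mulrA; congr (_ * _).
  by rewrite exprVn -{2}(prednK p_gt0) exprSr invfM mulrA mulfV ?mul1r ?expf_neq0.
elim/poly_ind: P => [|P c [u uE]].
  by exists (fun=> 0); rewrite rmorph0 big1 // => i _; rewrite expr0n gtn_eqF // mul0r.
(* Multiplication by y shifts the coefficients; the overflow u_(p-1)^p y^p is a p-th power and joins
   c^p in degree 0. *)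
exists (fun i => if i is j.+1 then u j else u p.-1 * y + c).
rewrite rmorphD rmorphM PhiX PhiC uE;
have pD a b : (a + b) ^+ p = a ^+ p + b ^+ p :> L := rmorphD (pFrobenius_aut hpL) a b.
case: (p) p_gt0 pD => // m _ pD.
rewrite big_ord_recr big_ord_recl /= pD expr0 mulr1 mulrDl mulr_suml.
rewrite -[_ * y ^+ m * y]mulrA -exprSr -exprMn -addrA addrC; congr (_ + _).
by apply: eq_bigr => i _; rewrite -mulrA -exprSr.
Qed.

End ChartPchar.

(** * Homogenization and affine charts *)

Definition tdeg_le (K : nzRingType) (k : nat) (A : {poly {poly K}}) : Prop :=
  forall a b, A`_b`_a != 0 -> (a + b <= k)%N.

Section Homogenization.
Variable (K : fieldType).
Implicit Types (i j : 'I_3) (A B : {poly {poly K}}) (a b : {mpoly K[3]}).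

(* Indices are taken modulo 3: the i-th affine chart has coordinates
   x = X_i / X_(i+2) and y = X_(i+1) / X_(i+2). *)
Definition dehom_var i j : {poly {poly K}} :=
  if j == i then 'X%:P else if j == i + 1 then 'X else 1.

Definition dehom i (a : {mpoly K[3]}) : {poly {poly K}} :=
  mmap (polyC \o polyC) (dehom_var i) a.

Lemma dehom_is_zmod_morphism i : zmod_morphism (dehom i).
Proof. exact: raddfB. Qed.

Lemma dehom_is_monoid_morphism i : monoid_morphism (dehom i).
Proof. by split; [exact: rmorph1|exact: rmorphM]. Qed.

HB.instance Definition _ i := GRing.isZmodMorphism.Build {mpoly K[3]}
  {poly {poly K}} (dehom i) (dehom_is_zmod_morphism i).
HB.instance Definition _ i := GRing.isMonoidMorphism.Build {mpoly K[3]}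
  {poly {poly K}} (dehom i) (dehom_is_monoid_morphism i).

Lemma ord3_cases i (Q : 'I_3 -> Prop) :
  Q i -> Q (i + 1) -> Q (i + 1 + 1) -> forall j, Q j.
Proof.
move=> Q0 Q1 Q2 j; have : j \in [:: i; i + 1; i + 1 + 1].
  by case: i j {Q0 Q1 Q2} => [[|[|[|i]]] hi] [[|[|[|j]]] hj].
by rewrite !inE => /or3P[] /eqP ->.
Qed.

Lemma ord3_neq i :
  [/\ (i + 1 == i) = false, (i + 1 + 1 == i) = false,
      (i + 1 + 1 == i + 1) = false & i + 1 + 1 + 1 = i].
Proof.
by case: i => [[|[|[|i]]] hi]; split=> //; apply/val_inj.
Qed.

Lemma dehomX i : dehom i 'X_i = 'X%:P.
Proof. by rewrite /dehom mmapX mmap1U /dehom_var eqxx. Qed.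

Lemma dehomX1 i : dehom i 'X_(i + 1) = 'X.
Proof.
by have [n1 _ _ _] := ord3_neq i; rewrite /dehom mmapX mmap1U /dehom_var n1 eqxx.
Qed.

Lemma dehomX2 i : dehom i 'X_(i + 1 + 1) = 1.
Proof.
have [_ n2 n3 _] := ord3_neq i.
by rewrite /dehom mmapX mmap1U /dehom_var n2 n3.
Qed.

Lemma mmap_dehom (L : fieldType) (kappa : {rmorphism K -> L}) (c : 'I_3 -> L)
    i k a :
  c (i + 1 + 1) != 0 -> a \is k.-homog ->
  mmap kappa c a = c (i + 1 + 1) ^+ k *
    biev kappa (c i / c (i + 1 + 1)) (c (i + 1) / c (i + 1 + 1)) (dehom i a).
Proof.
move=> z0 /dhomogP ha; have [n1 n2 n3 _] := ord3_neq i.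
set z := c (i + 1 + 1) in z0 *; set ev := biev _ _ _.
have evE j : ev (dehom_var i j) = c j / z.
  elim/(ord3_cases (i := i)): j; rewrite /dehom_var ?eqxx ?n1 ?n2 ?n3.
  - exact: bievCX.
  - exact: bievX.
  - by rewrite /ev rmorph1 divff.
rewrite /dehom /mmap /ev rmorph_sum mulr_sumr; apply: eq_big_seq => m /ha /= mk.
rewrite rmorphM /= bievCC mulrCA; congr (_ * _).
rewrite /mmap1 rmorph_prod /= -{}mk mdegE -prodrXr -big_split /=.
apply: eq_bigr => j _; rewrite rmorphXn /= -/ev evE -exprMn mulrC divfK //.
Qed.

(** Homogenization in degree k. The exponent k - (a + b) is truncated, so the result is a form of
    degree k under [tdeg_le k A]. *)
Definition hom i k A : {mpoly K[3]} :=
  \sum_(b < size A) \sum_(a < size A`_b)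
    A`_b`_a *: ('X_i ^+ a * 'X_(i + 1) ^+ b * 'X_(i + 1 + 1) ^+ (k - (a + b))).

Lemma hom_homog i k A : tdeg_le k A -> hom i k A \is k.-homog.
Proof.
move=> Ak; apply: rpred_sum => b _; apply: rpred_sum => a _.
have [->|/Ak ak] := eqVneq (A`_b`_a) 0; first by rewrite scale0r rpred0.
apply: rpredZ; set l := (k - (a + b))%N.
suff: ('X_i ^+ a * 'X_(i + 1) ^+ b * 'X_(i + 1 + 1) ^+ l : {mpoly K[3]})
    \is (1 * a + 1 * b + 1 * l).-homog by rewrite !mul1n subnKC.
by do 2?apply: dhomogM; apply: dhomogMn; rewrite dhomogX /= mdeg1.
Qed.

Lemma dehom_hom i k A : dehom i (hom i k A) = A.
Proof.
rewrite [in RHS](_ : A = \sum_(b < size A) A`_b *: 'X^b); last first.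
  by rewrite -[LHS]coefK poly_def.
rewrite /hom rmorph_sum; apply: eq_bigr => b _.
rewrite -mul_polyC -[X in X%:P]coefK poly_def rmorph_sum rmorph_sum mulr_suml.
apply: eq_bigr => a _; rewrite -mul_mpolyC !rmorphM !rmorphXn /=.
rewrite dehomX dehomX1 dehomX2 expr1n mulr1 mulrA /dehom mmapC /=.
by rewrite -mul_polyC rmorphM rmorphXn.
Qed.

Lemma tdeg_leW k l A : (k <= l)%N -> tdeg_le k A -> tdeg_le l A.
Proof. by move=> kl Ak a b /Ak /leq_trans; exact. Qed.

Lemma tdeg_le_exists A : exists k, tdeg_le k A.
Proof.
exists (\max_(b < size A) size (A`_b)%R + size A)%N => a b Aab.
have bA : (b < size A)%N.
  by rewrite ltnNge; apply: contra Aab => /(nth_default 0) ->; rewrite coef0.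
have aA : (a < size (A`_b)%R)%N.
  by rewrite ltnNge; apply: contra Aab => /(nth_default 0) ->.
apply: leq_add (ltnW bA); apply: (leq_trans (ltnW aA)).
by rewrite (bigD1 (Ordinal bA)) //= leq_maxl.
Qed.

End Homogenization.

Section HurwitzForm.
Variables (K : fieldType) (n : nat).
Implicit Types i j : 'I_3.

(** Cyclic symmetry of the form, which gives all three charts the same affine equation. *)
Lemma hurwitzE i : hurwitz K n = 'X_i ^+ n * 'X_(i + 1) +
  'X_(i + 1) ^+ n * 'X_(i + 1 + 1) + 'X_(i + 1 + 1) ^+ n * 'X_i.
Proof.
rewrite /hurwitz.
have -> : inord 0 = 0 :> 'I_3 by apply/val_inj; rewrite /= inordK.
have -> : inord 1 = 1 :> 'I_3 by apply/val_inj; rewrite /= inordK.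
have -> : inord 2 = 1 + 1 :> 'I_3 by apply/val_inj; rewrite /= inordK.
have [_ _ _ E] := ord3_neq 0; rewrite !add0r in E.
elim/(ord3_cases (i := 0)): i; rewrite !add0r ?E ?add0r //.
  by rewrite -addrA addrC.
by rewrite addrC addrA.
Qed.

Lemma dehom_hurwitz i : dehom i (hurwitz K n) = haff K n.
Proof.
rewrite (hurwitzE i) !rmorphD !rmorphM !rmorphXn /= dehomX dehomX1 dehomX2.
by rewrite expr1n mulr1 mul1r /haff -rmorphXn [_ * 'X + _]addrC.
Qed.

Lemma hurwitz_homog : hurwitz K n \is n.+1.-homog.
Proof.
have H i j : ('X_i ^+ n * 'X_j : {mpoly K[3]}) \is n.+1.-homog.
  suff: ('X_i ^+ n * 'X_j : {mpoly K[3]}) \is (1 * n + 1).-homog.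
    by rewrite mul1n addn1.
  by apply: dhomogM; [apply: dhomogMn|]; rewrite dhomogX /= mdeg1.
by rewrite /hurwitz !rpredD.
Qed.

(** The three coordinate points. They lie on the curve, and two of them are its only points on the
    line Z = 0. *)
Definition vertex (j : 'I_3) : 'I_3 -> K := fun l => (l == j)%:R.

Hypothesis n_gt0 : (0 < n)%N.

Lemma on_curve_vertex j : on_curve (hurwitz K n) (vertex j).
Proof.
split; first by exists j; rewrite /vertex eqxx oner_eq0.
have [n1 n2 n3 E] := ord3_neq j.
rewrite (hurwitzE j) !mevalD !mevalM !rmorphXn /= !mevalXU /vertex n1 n2.
by rewrite !expr0n gtn_eqF // !(mul0r, mulr0) !addr0.
Qed.

End HurwitzForm.

(** * The function field in the three affine charts *)

Section FunctionField.
Variables (K : fieldType) (n : nat) (X : function_field (hurwitz K n)).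
Hypothesis n_gt0 : (0 < n)%N.
Implicit Types i j : 'I_3.

Local Notation c := (ff_coord X).
Local Notation G := (hurwitz K n).

Definition xc i : X := c i / c (i + 1 + 1).
Definition yc i : X := c (i + 1) / c (i + 1 + 1).

(** Multiples of the equation vanish at [vertex K j], where the j-th coordinate does not. *)
Lemma ff_coord_neq0 j : c j != 0.
Proof.
apply/eqP => cj0.
have hX : ('X_j : {mpoly K[3]}) \is 1.-homog by rewrite dhomogX /= mdeg1.
have [b Xj] : exists b, 'X_j = b * G by apply/(ff_eq0 X hX); rewrite mmapX mmap1U.
have [_ G0] := on_curve_vertex K n_gt0 j.
have := congr1 (meval (vertex K j)) Xj.
by rewrite mevalM G0 mulr0 mevalXU /vertex eqxx => /eqP; rewrite oner_eq0.
Qed.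

Lemma ff_mmap_dehom i k a : a \is k.-homog -> mmap (ff_const X) c a =
  c (i + 1 + 1) ^+ k * biev (ff_const X) (xc i) (yc i) (dehom i a).
Proof. exact/mmap_dehom/ff_coord_neq0. Qed.

(** A relation between the affine coordinates is homogenized, becomes a multiple of the form by
    [ff_eq0], and is dehomogenized again. *)
Lemma ff_chart i : chart n (ff_const X) (xc i) (yc i).
Proof.
have zX k : c (i + 1 + 1) ^+ k != 0 by rewrite expf_neq0 ?ff_coord_neq0.
split=> [A|f]; last first.
  have [k [a [b [ha hb b0 ->]]]] := ff_quotient f; exists (dehom i a), (dehom i b).
  move: b0; rewrite !(ff_mmap_dehom i (k := k)) // mulf_eq0 negb_or => /andP[_ b0].
  by split=> //; rewrite invfM mulrACA mulfV // mul1r.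
have h0 : biev (ff_const X) (xc i) (yc i) (haff K n) = 0.
  have /(ff_eq0 X (hurwitz_homog K n))/eqP : exists b, G = b * G.
    by exists 1; rewrite mul1r.
  rewrite (ff_mmap_dehom i (hurwitz_homog K n)) mulf_eq0 (negPf (zX _)) /=.
  by rewrite dehom_hurwitz => /eqP.
split=> [A0|[B ->]]; last by rewrite rmorphM /= h0 mulr0.
have [k Ak] := tdeg_le_exists A.
have [b hE] : exists b, hom i k A = b * G.
  apply/(ff_eq0 X (hom_homog i Ak)).
  by rewrite (ff_mmap_dehom i (hom_homog i Ak)) dehom_hom A0 mulr0.
exists (dehom i b).
by rewrite -(dehom_hom i k A) hE rmorphM /= dehom_hurwitz.
Qed.

Lemma ff_neq0_on_curve (P : 'I_3 -> K) k (b : {mpoly K[3]}) :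
  on_curve G P -> b \is k.-homog -> b.@[P] != 0 -> mmap (ff_const X) c b != 0.
Proof.
move=> [_ PG] hb; apply: contra => /eqP b0.
have /(ff_eq0 X hb)[q ->] := b0.
by rewrite mevalM PG mulr0.
Qed.

Definition chart_at (P : 'I_3 -> K) i (A : {poly {poly K}}) : K :=
  biev idfun (P i / P (i + 1 + 1)) (P (i + 1) / P (i + 1 + 1)) A.

Lemma regular_at_chart (P : 'I_3 -> K) i (f : X) : P (i + 1 + 1) != 0 ->
  regular_at P f <-> exists A B, chart_at P i B != 0 /\
    f = biev (ff_const X) (xc i) (yc i) A / biev (ff_const X) (xc i) (yc i) B.
Proof.
move=> Pz.
have zX k : c (i + 1 + 1) ^+ k != 0 by rewrite expf_neq0 ?ff_coord_neq0.
have PE k b : b \is k.-homog ->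
    b.@[P] = P (i + 1 + 1) ^+ k * chart_at P i (dehom i b).
  by move=> hb; rewrite -[LHS]/(mmap idfun P b) (mmap_dehom idfun Pz hb).
split=> [[k [a [b [ha hb b0 ->]]]]|[A [B [B0 ->]]]].
  exists (dehom i a), (dehom i b); move: b0; rewrite (PE k) //.
  rewrite mulf_eq0 negb_or => /andP[_ b0].
  split=> //; rewrite !(ff_mmap_dehom i (k := k)) //.
  by rewrite invfM mulrACA mulfV // mul1r.
have [[k Ak] [l Bl]] := (tdeg_le_exists A, tdeg_le_exists B).
(* Numerator and denominator must be forms of one degree, hence the maximum of the two bounds. *)
have hA := hom_homog i (tdeg_leW (leq_maxl k l) Ak).
have hB := hom_homog i (tdeg_leW (leq_maxr k l) Bl).
exists (maxn k l), (hom i (maxn k l) A), (hom i (maxn k l) B); split=> //.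
  by rewrite (PE _ _ hB) dehom_hom mulf_neq0 ?expf_neq0.
rewrite !(ff_mmap_dehom i (k := maxn k l)) // !dehom_hom.
by rewrite invfM mulrACA mulfV // mul1r.
Qed.

End FunctionField.

(** * Regular differentials *)

Lemma derivation_derivative (K F : fieldType) (iota : {rmorphism K -> F})
  (M : lmodType F) (D : F -> M) : derivation iota D -> derivative D.
Proof. by case. Qed.

Section Differentials.
Variables (K : closedFieldType) (p s : nat).
Hypotheses (hp : p \in [pchar K]) (s_gt0 : (0 < s)%N).
Variables (X : function_field (hurwitz K (s * p))) (W : differentials (ff_const X)).
Implicit Types (i j : 'I_3) (f g : X) (P : 'I_3 -> K).

Local Notation n := (s * p)%N.
Local Notation c := (ff_coord X).
Local Notation G := (hurwitz K n).
Local Notation d := (diff W).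
Local Notation ev i := (biev (ff_const X) (xc X i) (yc X i)).

Let n_gt1 : (1 < n)%N.
Proof. exact: leq_trans (prime_gt1 (pcharf_prime hp)) (leq_pmull _ s_gt0). Qed.

Let n_gt0 : (0 < n)%N. Proof. exact: ltnW. Qed.

Let n0 : n%:R = 0 :> K. Proof. by rewrite natrM (pcharf0 hp) mulr0. Qed.

Let xy i : chart n (ff_const X) (xc X i) (yc X i).
Proof. exact: ff_chart. Qed.

Let hpX : p \in [pchar X]. Proof. by rewrite (fmorph_pchar (ff_const X)). Qed.

Let dd : derivative d.
Proof. exact: derivation_derivative (diff_derivation W). Qed.

Lemma diff_chart i (D : X -> X) :
  derivative (D : X -> X^o) -> D (yc X i) = 1 ->
  forall f, d f = D f *: d (yc X i).
Proof.
move=> dD Dy.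
exact: (derivative_pbasis hpX (chart_pbasis hp (xy i)) dD Dy dd).
Qed.

(** By the universal property d/dy factors through [d], and it takes the value 1 at y. *)
Lemma diff_yc_neq0 i : d (yc X i) != 0.
Proof.
have [D [dD Dy DE]] := chart_derivation (xy i) n0.
have dK : derivation (ff_const X) (D : X -> X^o).
  case: (dD) => ? ?; split=> // k.
  have [z ->] := closed_pth_root k (prime_gt0 (pcharf_prime hp)).
  by rewrite rmorphXn; exact: (derivative_pth dD hpX).
have [phi phiE _] := diff_universal W dK.
by apply/eqP => y0; have /eqP := phiE (yc X i); rewrite y0 linear0 Dy eq_sym oner_eq0.
Qed.

Lemma chart_at_curve P i : on_curve G P -> P (i + 1 + 1) != 0 ->
  chart_at P i (haff K n) = 0.
Proof.
move=> [_ GP] Pz; rewrite -(dehom_hurwitz K n i).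
have := mmap_dehom idfun Pz (hurwitz_homog K n).
rewrite -[LHS]/(G.@[P]) GP => /esym/eqP.
by rewrite mulf_eq0 expf_eq0 (negPf Pz) andbF => /eqP.
Qed.

Lemma chart_at_neq0 P i B : on_curve G P -> P (i + 1 + 1) != 0 ->
  chart_at P i B != 0 -> ev i B != 0.
Proof.
move=> PG Pz; apply: contra => /eqP /(xy i).1[q ->].
by rewrite /chart_at rmorphM /= -!/(chart_at _ _ _) chart_at_curve // mulr0.
Qed.

Lemma regular_atD P f g : on_curve G P ->
  regular_at P f -> regular_at P g -> regular_at P (f + g).
Proof.
move=> PG; have [[j Pj] _] := PG.
have [i iE] : exists i, P (i + 1 + 1) != 0.
  exists (j + 1).
  by have [_ _ _ ->] := ord3_neq j.
rewrite !(regular_at_chart n_gt0 _ iE) => -[A [B [B0 ->]]] [A' [B' [B0' ->]]].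
exists (A * B' + A' * B), (B * B').
split; first by rewrite /chart_at rmorphM mulf_neq0.
by rewrite rmorphD !rmorphM /= addf_div ?(chart_at_neq0 PG iE).
Qed.

Lemma regular_atM P f g :
  regular_at P f -> regular_at P g -> regular_at P (f * g).
Proof.
move=> [k [a [b [ha hb b0 ->]]]] [l [a' [b' [ha' hb' b0' ->]]]].
exists (k + l)%N, (a * a'), (b * b').
by rewrite !dhomogM // mevalM mulf_neq0 // !rmorphM /= mulf_div.
Qed.

Lemma regular_at_ev P i A : P (i + 1 + 1) != 0 -> regular_at P (ev i A).
Proof.
move=> Pz; apply/(regular_at_chart n_gt0 _ Pz); exists A, 1.
by rewrite /chart_at !rmorph1 oner_eq0 divr1.
Qed.

(** The quotient rule squares the denominator, which stays non-zero at P. *)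
Lemma regular_at_derivation P i (D : X -> X) f :
  derivative (D : X -> X^o) -> (forall A, D (ev i A) = ev i (hder n A)) ->
  on_curve G P -> P (i + 1 + 1) != 0 -> regular_at P f -> regular_at P (D f).
Proof.
move=> dD DE PG Pz.
rewrite !(regular_at_chart n_gt0 _ Pz) => -[A [B [B0 ->]]].
exists (B * hder n A - A * hder n B), (B * B).
have evB := chart_at_neq0 PG Pz B0.
split; first by rewrite /chart_at rmorphM mulf_neq0.
have DM u v : D (u * v) = u * D v + v * D u := derivativeM dD u v.
have DV v : v != 0 -> D v^-1 = - v ^- 2 * D v by exact: (derivativeV dD).
rewrite DM DV // !DE; move: (hder n A) (hder n B) => A' B'.
by rewrite bievB !bievM; field.
Qed.

(** The stalk at P is generated by the differential of y: the differential of g is D g times it, and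
    D preserves regularity at P. *)
Lemma regular_diff_chart P i (w : W) : on_curve G P -> P (i + 1 + 1) != 0 ->
  regular_diff_at P w <-> exists2 f, regular_at P f & w = f *: d (yc X i).
Proof.
move=> PG Pz; split=> [[m [f [g [hf hg ->]]]]|[f hf ->]]; last first.
  exists 1%N, (fun=> f), (fun=> yc X i); split=> //; last by rewrite big_ord1.
  by move=> _; rewrite -[yc X i](bievX (ff_const X) (xc X i)); exact: regular_at_ev.
have [D [dD Dy DE]] := chart_derivation (xy i) n0.
exists (\sum_j f j * D (g j)).
  elim/big_ind: _ => [|u v|j _]; [|exact: regular_atD|].
    by rewrite -(rmorph0 (ev i)); exact: regular_at_ev.
  by apply: regular_atM => //; apply: (regular_at_derivation (i := i)).
rewrite scaler_suml; apply: eq_bigr => j _.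
by rewrite (diff_chart dD Dy) scalerA.
Qed.

Lemma diff_xc i : d (xc X i) = - xc X i ^+ n *: d (yc X i).
Proof.
have [D [dD Dy DE]] := chart_derivation (xy i) n0.
rewrite (diff_chart dD Dy); congr (_ *: _).
have -> : D (xc X i) = ev i (hder n 'X%:P) by rewrite -DE bievCX.
rewrite /hder derivC.
have -> : map_poly (@deriv K) 'X%:P = 1%:P.
  by apply/polyP => j; rewrite coef_map !coefC /=; case: eqP; rewrite ?derivX ?raddf0.
by rewrite -polyCM mulr1 sub0r bievN bievC map_polyXn hornerXn.
Qed.

(* Multiplication by eta identifies the sections of O(n - 2), as elements of
   degree n - 2 in the homogeneous coordinates c, with the differentials. *)
Definition eta i : W := c (i + 1 + 1) ^- (n - 2) *: d (yc X i).

(** The next chart has y' = 1/x, so dy' = -x^(-2) dx = x^(n-2) dy, and this factor is the one by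
    which the coordinate powers differ. *)
Lemma etaE i j : eta i = eta j.
Proof.
have c0 := ff_coord_neq0 X n_gt0.
suff H k : eta (k + 1) = eta k.
  by elim/(ord3_cases (i := i)): j; rewrite ?H.
have [_ _ _ E] := ord3_neq k.
have yE : yc X (k + 1) = (xc X k)^-1.
  by rewrite /yc /xc E invf_div.
have x0 : xc X k != 0 by rewrite mulf_neq0 ?invr_eq0 ?c0.
rewrite /eta yE (derivativeV dd) // diff_xc !scalerA E; congr (_ *: _).
have xn : xc X k ^+ n = xc X k ^+ (n - 2) * xc X k ^+ 2.
  by rewrite -exprD subnK.
rewrite xn mulrN mulrN mulNr opprK [xc X k ^+ (n - 2) * _]mulrC -mulrA.
by rewrite mulKf ?expf_neq0 // expr_div_n mulKf ?expf_neq0 ?c0.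
Qed.

(** The canonical sheaf of a smooth plane curve of degree n + 1 is O(n - 2), here trivialized chart
    by chart through [eta]. *)
Lemma holomorphicP (w : W) : holomorphic w <->
  exists2 phi, (forall P i, on_curve G P -> P (i + 1 + 1) != 0 ->
      regular_at P (phi / c (i + 1 + 1) ^+ (n - 2)))
    & w = phi *: eta 0.
Proof.
have c0 k j : c j ^+ k != 0 by rewrite expf_neq0 ?(ff_coord_neq0 X n_gt0).
split=> [hw|[phi hphi ->] P PG]; last first.
  have [[j Pj] _] := PG; have [_ _ _ E] := ord3_neq j; rewrite -E in Pj.
  apply/(regular_diff_chart _ PG Pj).
  exists (phi / c (j + 1 + 1 + 1) ^+ (n - 2)); first exact: hphi.
  by rewrite (etaE 0 (j + 1)) scalerA.
have vG := on_curve_vertex K n_gt0.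
(* One point off Z = 0 produces phi. In every other chart the coefficient of w must agree with this
   phi, as the differential of y is non-zero there. *)
have [||f _ wE] := (regular_diff_chart w (i := 0) (vG (0 + 1 + 1)) _).1.
- by rewrite /vertex eqxx oner_eq0.
- exact: hw.
have wphi : w = (f * c (0 + 1 + 1) ^+ (n - 2)) *: eta 0.
  by rewrite /eta scalerA mulfK.
exists (f * c (0 + 1 + 1) ^+ (n - 2)) => // P i PG Pz.
have [g hg gE] := (regular_diff_chart w PG Pz).1 (hw P PG).
move: wphi; rewrite (etaE 0 i) scalerA gE => /eqP.
rewrite -subr_eq0 -scalerBl scaler_eq0 (negPf (diff_yc_neq0 i)) orbF subr_eq0.
by move=> /eqP <-.
Qed.

End Differentials.

(** * Global sections of O(m) *)

(** The cofactor h of gcd(f, A) in f is prime to A / gcd(f, A). At a root r of h it would have to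
    divide b, but b(r) is non-zero; so h is constant. *)
Lemma dvdp_local (K : closedFieldType) (f A : {poly K}) : f != 0 ->
  (forall r, root f r -> exists2 b, b.[r] != 0 & f %| b * A) -> f %| A.
Proof.
move=> f0 floc; set g := gcdp f A; set h := f %/ g.
have g0 : g != 0 by rewrite gcdp_eq0 negb_and f0.
have fE : f = h * g by rewrite divpK // dvdp_gcdl.
have AE : A = (A %/ g) * g by rewrite divpK // dvdp_gcdr.
have cop : coprimep h (A %/ g) by rewrite coprimep_div_gcd // f0.
rewrite fE AE dvdp_mul2r //; apply: dvdUp; rewrite -size_poly_eq1.
apply/negPn/negP => /closed_rootP[r hr].
have /floc[b b0] : root f r by rewrite fE rootM hr.
rewrite {1}fE {1}AE mulrA dvdp_mul2r // Gauss_dvdpl // => hb.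
move/negP: b0; apply; rewrite -/(root b r) -dvdp_XsubCl.
by apply: dvdp_trans hb; rewrite dvdp_XsubCl.
Qed.

Section HaffSize.
Variables (K : fieldType) (n : nat).
Hypothesis n_gt1 : (1 < n)%N.

Lemma size_haff : size (haff K n) = n.+1.
Proof.
rewrite /haff -addrA size_polyDl ?size_polyXn //.
rewrite ltnS (leq_trans (size_polyD _ _)) // geq_max.
rewrite (leq_trans (size_polyMleq _ _)) ?(leq_trans (size_polyC_leq1 _))
  ?(ltnW n_gt1) //.
rewrite size_polyX addn2 /=; apply: leq_trans n_gt1.
by rewrite ltnS size_polyC_leq1.
Qed.

Lemma monic_haff : haff K n \is monic.
Proof.
rewrite monicE lead_coefE size_haff /haff -addrA coefD coefXn eqxx /=.
rewrite coefD coefMX !coefC !gtn_eqF ?addr0 ?(ltnW n_gt1) //.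
by rewrite -ltnS prednK ?(ltnW n_gt1).
Qed.

End HaffSize.

Section ChartInjective.
Variables (K : fieldType) (L : fieldType) (n : nat).
Hypothesis n_gt1 : (1 < n)%N.
Variables (kappa : {rmorphism K -> L}) (x y : L).
Hypothesis xy : chart n kappa x y.

Local Notation ev := (biev kappa x y).
Local Notation haff := (haff K n).

(** The equation is monic of degree n in y, so 1, y, ..., y^(n-1) are independent over K[x]. *)
Lemma biev_eq0_size A : ev A = 0 -> (size A <= n)%N -> A = 0.
Proof.
move=> /xy.1[B ->]; have [->|B0] := eqVneq B 0; first by rewrite mul0r.
rewrite size_Mmonic ?monic_haff // size_haff //.
by rewrite addnS /= -[X in (_ <= X)%N]add0n leq_add2r leqn0 size_poly_eq0 (negPf B0).
Qed.

Lemma bievC_neq0 q : q != 0 -> ev q%:P != 0.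
Proof.
apply: contra => /eqP /biev_eq0_size; rewrite -polyC_eq0 => -> //.
by rewrite (leq_trans (size_polyC_leq1 _)) // ltnW.
Qed.

End ChartInjective.

(** * Functions regular on the affine part are polynomials *)

Section AffineSections.
Variables (K : closedFieldType) (L : fieldType) (n : nat).
Hypothesis n_gt1 : (1 < n)%N.
Variables (kappa : {rmorphism K -> L}) (x y : L).
Hypothesis xy : chart n kappa x y.

Local Notation ev := (biev kappa x y).
Local Notation haff := (haff K n).

Let cst : {rmorphism {poly K} -> L} := horner_eval x \o map_poly kappa.

Let cstE q : cst q = ev q%:P. Proof. by rewrite bievC. Qed.

Lemma biev_integral B : integralOver cst (ev B).
Proof.
have -> : ev B = (map_poly cst B).[y] by [].
apply: integral_horner.
  by apply/integral_poly => i; rewrite coef_map; exact: integral_id.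
exists haff; first exact: monic_haff.
exact/eqP/(chart_haff xy).
Qed.

(** B is integral over K[x]. Once powers of the unknown are cancelled from an integral equation, its
    constant term q is non-zero and a multiple of B. Denominators can thus be taken in x alone. *)
Lemma biev_denominator B : ev B != 0 ->
  exists q C, q != 0 /\ ev q%:P = ev B * ev C.
Proof.
move=> B0; have [P /monic_neq0] := biev_integral B.
elim/poly_ind: P => [|P q IHP]; first by rewrite eqxx.
have [-> |q0 _] := eqVneq q 0.
  rewrite addr0 mulf_eq0 negb_or => /andP[P0 _].
  rewrite rmorphM /= map_polyX rootM => /orP[|]; first exact: IHP.
  by rewrite /root hornerX (negPf B0).
rewrite /root rmorphD rmorphM /= map_polyX map_polyC hornerMXaddC.
rewrite -[X in _ + X]/(cst q) cstE => /eqP H.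
exists q, (- (map_poly polyC P).[B]); split=> //.
rewrite bievN -horner_map -map_poly_comp /=.
have -> : map_poly (ev \o polyC) P = map_poly cst P.
  by apply: eq_map_poly => u; rewrite cstE.
by apply/eqP; rewrite mulrN -addr_eq0 addrC mulrC; exact/eqP.
Qed.

Lemma biev_fraction f : exists q A, q != 0 /\ ev q%:P * f = ev A.
Proof.
have [A [B [B0 ->]]] := xy.2 f; have [q [C [q0 qE]]] := biev_denominator B0.
by exists q, (C * A); split=> //; rewrite qE rmorphM /=; field.
Qed.

Definition local_at (a b : K) (f : L) : Prop :=
  exists A B, biev idfun a b B != 0 /\ f = ev A / ev B.

Lemma local_atM a b f g : local_at a b f -> local_at a b g -> local_at a b (f * g).
Proof.
move=> [A [B [B0 ->]]] [C [D [D0 ->]]]; exists (A * C), (B * D).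
by rewrite !rmorphM /= mulf_neq0 // mulf_div.
Qed.

Lemma local_at_ev a b A : local_at a b (ev A).
Proof. by exists A, 1; rewrite !rmorph1 oner_eq0 divr1. Qed.

Let at_x (a : K) : {rmorphism {poly {poly K}} -> {poly K}} :=
  map_poly (horner_eval a).

Lemma biev_id a b A : biev idfun a b A = (at_x a A).[b].
Proof.
rewrite /biev; congr (_.[b]); apply/polyP => i; rewrite coef_map_id0 ?coef_map //.
  by rewrite /horner_eval map_poly_id.
by rewrite raddf0 horner0.
Qed.

Lemma at_x_eq0 a A : at_x a A = 0 -> exists B, A = ('X - a%:P)%:P * B.
Proof.
move=> A0; exists (map_poly (fun q : {poly K} => q %/ ('X - a%:P)) A).
apply/polyP => i; rewrite coefCM coef_map_id0 ?div0p // mulrC divpK //.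
by rewrite dvdp_XsubCl; apply/eqP; rewrite -[LHS](coef_map (horner_eval a)) A0 coef0.
Qed.

(* On the line x = a, the multiplicity of haff at each of its zeros is at most
   that of A, so haff divides A there. *)
Lemma local_divX a (g : L) A : ev ('X - a%:P)%:P * g = ev A ->
  (forall b, biev idfun a b haff = 0 -> local_at a b g) -> exists B, g = ev B.
Proof.
move=> gA gloc; have t0 : ev ('X - a%:P)%:P != 0.
  by apply: (bievC_neq0 n_gt1 xy); rewrite polyXsubC_eq0.
have h0 : at_x a haff \is monic by apply: monic_map; exact: monic_haff.
have hA : at_x a haff %| at_x a A.
  apply: dvdp_local => [|b hb]; first exact: monic_neq0.
  have hb0 : biev idfun a b haff = 0 by rewrite biev_id; exact/eqP.
  have [A' [B [B0 gE]]] := gloc b hb0.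
  have Bn0 : ev B != 0.
    by apply: contra B0 => /eqP/xy.1[E ->]; rewrite rmorphM /= hb0 mulr0.
  exists (at_x a B); first by rewrite -biev_id.
  have /xy.1[E] : ev (B * A - ('X - a%:P)%:P * A') = 0.
    rewrite bievB !bievM -gA gE.
    by apply/eqP; rewrite subr_eq0 mulrCA [ev B * _]mulrC divfK.
  move=> /(congr1 (at_x a)); rewrite rmorphB !rmorphM.
  have -> : at_x a ('X - a%:P)%:P = 0.
    by rewrite /= map_polyC /= /horner_eval hornerXsubC subrr.
  by rewrite mul0r subr0 => ->; exact: dvdp_mull.
have [q qE] := dvdpP _ _ hA.
(* The cofactor q on the line x = a is lifted to a polynomial in y with constant coefficients. The
   difference then vanishes on that line, and subtracting a multiple of [haff] does not change the
   value in L. *)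
have [|B BE] := @at_x_eq0 a (A - map_poly polyC q * haff).
  rewrite rmorphB rmorphM /= -map_poly_comp.
  have -> : map_poly (horner_eval a \o polyC) q = q.
    by apply: map_poly_id => u _; rewrite /= /horner_eval hornerC.
  by apply/eqP; rewrite subr_eq0; exact/eqP.
exists B; apply: (mulfI t0); rewrite gA -bievM -BE bievB bievM.
by rewrite (chart_haff xy) mulr0 subr0.
Qed.

(** Induction on the degree of the denominator q = r(x) (x - a): [local_divX] applied to r f shows
    that r is a denominator too. *)
Lemma chart_sections f :
  (forall a b, biev idfun a b haff = 0 -> local_at a b f) -> exists A, f = ev A.
Proof.
have [q [A [q0 qA]]] := biev_fraction f.
have [m] := ubnP (size q); elim: m => // m IHm in q A f q0 qA * => sq floc.
have [/closed_rootP[a /factor_theorem[r qE]]|] := boolP (size q != 1%N).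
  have r0 : r != 0 by apply: contra q0 => /eqP r0; rewrite qE r0 mul0r.
  have [|b hb|B BE] := @local_divX a (ev r%:P * f) A.
  - by rewrite mulrA -rmorphM -polyCM mulrC [_ * r]mulrC -qE mulrC.
  - by apply: local_atM (floc _ _ hb); exact: local_at_ev.
  - apply: (IHm r B) => //.
    by move: sq; rewrite qE size_Mmonic ?monicXsubC // size_XsubC addn2.
rewrite negbK => /size_poly1P[k k0 qE].
exists (k^-1%:P%:P * A); rewrite rmorphM /= -qA qE !bievCC mulrA -rmorphM mulVf //.
by rewrite rmorph1 mul1r.
Qed.

End AffineSections.

Section BoundedDegree.
Variables (K L : fieldType) (kappa : {rmorphism K -> L}) (x y : L).

Definition bounded (k : nat) (f : L) : Prop :=
  exists A, tdeg_le k A /\ f = biev kappa x y A.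

Lemma boundedD k f g : bounded k f -> bounded k g -> bounded k (f + g).
Proof.
move=> [A [Ak ->]] [B [Bk ->]]; exists (A + B); split; last by rewrite rmorphD.
move=> a b; rewrite !coefD; have [A0|/Ak //] := eqVneq A`_b`_a 0.
by rewrite A0 add0r => /Bk.
Qed.

Lemma boundedN k f : bounded k f -> bounded k (- f).
Proof.
move=> [A [Ak ->]]; exists (- A); split; last by rewrite bievN.
by move=> a b; rewrite !coefN oppr_eq0 => /Ak.
Qed.

Lemma bounded0 k : bounded k 0.
Proof.
by exists 0; split=> [a b|]; rewrite ?rmorph0 // !coef0 eqxx.
Qed.

Lemma bounded_sum k (I : Type) (r : seq I) (P : pred I) (E : I -> L) :
  (forall i, P i -> bounded k (E i)) -> bounded k (\sum_(i <- r | P i) E i).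
Proof.
by move=> H; elim/big_ind: _ => //; [exact: bounded0|exact: boundedD].
Qed.

Lemma bounded_monomial k c a b :
  (a + b <= k)%N -> bounded k (kappa c * x ^+ a * y ^+ b).
Proof.
move=> abk; exists ((c *: 'X^a)%:P * 'X^b); split=> [a' b'|].
  rewrite coefCM coefXn mulr_natr mulrb.
  have [->|_] := eqVneq b' b; last by rewrite coef0 eqxx.
  rewrite coefZ coefXn mulr_natr mulrb.
  by have [->|_] := eqVneq a' a; last by rewrite eqxx.
by rewrite -mul_polyC polyCM rmorphXn /= !rmorphM /= !rmorphXn /= bievCC bievCX bievX.
Qed.

Lemma bievE A : biev kappa x y A =
  \sum_(b < size A) \sum_(a < size A`_b) kappa A`_b`_a * x ^+ a * y ^+ b.
Proof.
rewrite -[in LHS](coefK A) poly_def rmorph_sum; apply: eq_bigr => b _.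
rewrite -mul_polyC rmorphM rmorphXn /= bievX bievC -mulr_suml; congr (_ * _).
by rewrite horner_coef size_map_poly; apply: eq_bigr => a _; rewrite coef_map.
Qed.

End BoundedDegree.

(** * Degree bound from the points at infinity *)

Section GlobalSections.
Variables (K : closedFieldType) (n : nat) (X : function_field (hurwitz K n)).
Hypothesis n_gt1 : (1 < n)%N.

Local Notation c := (ff_coord X).
Local Notation G := (hurwitz K n).
Local Notation x := (xc X 0).
Local Notation y := (yc X 0).
Local Notation z := (0 + 1 + 1 : 'I_3).
Local Notation ev := (biev (ff_const X) x y).

Let n_gt0 : (0 < n)%N. Proof. exact: ltnW. Qed.

Lemma sum_coef (R : nzRingType) (q : {poly R}) l :
  \sum_(a < size q) (if a == l :> nat then q`_a else 0) = q`_l.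
Proof.
rewrite -[in RHS](coefK q) poly_def coef_sum; apply: eq_bigr => a _.
by rewrite coefZ coefXn eq_sym mulr_natr mulrb.
Qed.

(* Restriction to the line Z = 0, with Y = 1. *)
Definition infty_var (j : 'I_3) : {poly K} :=
  if j == 0 then 'X else if j == 0 + 1 then 1 else 0.

(** On Z = 0 only the monomials of total degree exactly D survive. *)
Lemma infty_hom D A i : tdeg_le D A -> (i <= D)%N ->
  (mmap polyC infty_var (hom 0 D A))`_i = A`_(D - i)`_i.
Proof.
move=> AD iD; rewrite /hom rmorph_sum coef_sum.
rewrite -[in RHS](sum_coef A (D - i)%N) coef_sum; apply: eq_bigr => b _.
rewrite rmorph_sum coef_sum /=.
have vE j : mmap polyC infty_var 'X_j = infty_var j by rewrite mmapX mmap1U.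
transitivity (\sum_(a < size A`_b) if a == i :> nat then
    (if (b == D - i :> nat)%N then A`_b`_a else 0) else 0).
  apply: eq_bigr => a _; rewrite -mul_mpolyC !rmorphM !rmorphXn /= mmapC !vE.
  rewrite /infty_var /= expr1n mulr1.
  rewrite coefCM expr0n subn_eq0 mulr_natr mulrb.
  have [->|/AD abD] := eqVneq A`_b`_a 0; first by rewrite mul0r !if_same.
  case: leqP => Dab; last first.
    rewrite coef0 mulr0; case: eqP => // aE; case: eqP => // bE.
    by move: Dab; rewrite aE bE subnKC ?ltnn.
  rewrite coefXn eq_sym mulr_natr mulrb; case: eqP => // aE.
  by rewrite ifT // -(eqn_add2l i) subnKC // -aE eqn_leq abD.
case: eqP => [->|_]; last by rewrite coef0 big1 // => a _; rewrite if_same.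
exact: sum_coef.
Qed.

Lemma vertex0_hom D A : tdeg_le D A ->
  (hom 0 D A).@[vertex K 0] = A`_0`_D.
Proof.
move=> AD; rewrite /hom rmorph_sum.
rewrite -[in RHS](sum_coef A 0) coef_sum; apply: eq_bigr => b _.
rewrite rmorph_sum /=.
transitivity (\sum_(a < size A`_b) if a == D :> nat then
    (if b == 0%N :> nat then A`_b`_a else 0) else 0).
  apply: eq_bigr => a _; rewrite mevalZ !mevalM !rmorphXn /= !mevalXU /vertex.
  rewrite /= expr1n mul1r.
  have [->|/AD abD] := eqVneq A`_b`_a 0; first by rewrite mul0r !if_same.
  rewrite !expr0n; case: eqP => [b0|_]; last by rewrite mul0r mulr0 if_same.
  have ab : (a + b = a)%N by rewrite -[RHS]addn0; exact: congr1 b0.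
  rewrite mul1r subn_eq0 ab mulr_natr mulrb; congr (if _ then _ else _).
  by rewrite eqn_leq -{2}ab abD.
case: eqP => [->|_]; last by rewrite coef0 big1 // => a _; rewrite if_same.
exact: sum_coef.
Qed.

(** Denominators are cleared in the expression of the function as a / b near the vertex; the
    identity of forms holds in the function field, hence modulo the equation of the curve. *)
Lemma regular_vertex_relation D A m j :
  tdeg_le D A -> (m <= D)%N ->
  regular_at (vertex K j) (c z ^+ m * ev A / c j ^+ m) ->
  exists a b e, b.@[vertex K j] != 0 /\
    hom 0 D A * b = 'X_z ^+ (D - m) * 'X_j ^+ m * a + e * G.
Proof.
move=> AD mD [k [a [b [ha hb b0 E]]]].
have c0 l i : c i ^+ l != 0 by rewrite expf_neq0 ?(ff_coord_neq0 X n_gt0).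
have hH := hom_homog 0 AD.
have hX l i : ('X_i ^+ l : {mpoly K[3]}) \is l.-homog.
  by rewrite -[X in _ \is X.-homog]mul1n; apply: dhomogMn; rewrite dhomogX /= mdeg1.
have bn0 := ff_neq0_on_curve X (on_curve_vertex K n_gt0 j) hb b0.
have h1 := dhomogM hH hb.
have h2 : 'X_z ^+ (D - m) * 'X_j ^+ m * a \is (D + k).-homog.
  by rewrite -[in (D + k)%N](subnK mD); do 2?apply: dhomogM.
have /(ff_eq0 X (rpredB h1 h2))[e eE] : mmap (ff_const X) c
    (hom 0 D A * b - 'X_z ^+ (D - m) * 'X_j ^+ m * a) = 0.
  rewrite rmorphB !rmorphM !rmorphXn /= !mmapX !mmap1U (ff_mmap_dehom X n_gt0 0 hH).
  rewrite dehom_hom -(subnK mD) exprD addnK.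
  apply/eqP; rewrite subr_eq0 -!mulrA; apply/eqP; congr (_ * _).
  by move/eqP: E; rewrite eqr_div // => /eqP E; rewrite mulrA E mulrC.
exists a, b, e; split=> //.
by rewrite -eE addrC subrK.
Qed.

(** Since D > m, the relation at each vertex makes the leading form vanish on Z = 0 modulo the
    equation. So its monomials are divisible by x^n y, which the equation of the curve replaces by
    terms of lower degree. *)
Lemma infty_step D A m :
  tdeg_le D A -> (m < D)%N ->
  (forall j, regular_at (vertex K j) (c z ^+ m * ev A / c j ^+ m)) ->
  bounded (ff_const X) x y D.-1 (ev A).
Proof.
move=> AD mD reg; have mD' := ltnW mD.
have Dm0 : (D - m)%N != 0%N by rewrite subn_eq0 -ltnNge.
(* Evaluation at (1 : 0 : 0), where Z and the equation vanish and b does not. *)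
have AD0 : A`_0`_D = 0.
  have [a [b [e [b0 E]]]] := regular_vertex_relation AD mD' (reg 0).
  have [_ G0] := on_curve_vertex K n_gt0 0.
  move: (congr1 (meval (vertex K 0)) E).
  rewrite mevalD !mevalM G0 mulr0 addr0 !rmorphXn /= mevalXU {2}/vertex /=.
  rewrite expr0n (negPf Dm0) !mul0r vertex0_hom // => /eqP.
  by rewrite mulf_eq0 (negPf b0) orbF => /eqP.
(* Restriction to Z = 0, Y = 1, where the equation becomes X^n. As b does not vanish at (0 : 1 : 0),
   its restriction is prime to X and X^n divides the leading form. *)
have lead0 i : (i < n)%N -> (i <= D)%N -> A`_(D - i)`_i = 0.
  have [a [b [e [b0 E]]]] := regular_vertex_relation AD mD' (reg (0 + 1)).
  pose theta : {rmorphism {mpoly K[3]} -> {poly K}} := mmap polyC infty_var.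
  have tX j : theta 'X_j = infty_var j by rewrite /= mmapX mmap1U.
  have tz : theta 'X_z = 0 by rewrite tX.
  have tG : theta G = 'X^n.
    rewrite (hurwitzE K n 0) !rmorphD !rmorphM !rmorphXn !tX /infty_var /=.
    by rewrite mulr1 mulr0 expr0n gtn_eqF // mul0r !addr0.
  move=> iN iD; rewrite -(infty_hom AD iD) -[mmap _ _ _]/(theta (hom 0 D A)).
  have : 'X^n %| theta (hom 0 D A) * theta b.
    rewrite -rmorphM E rmorphD !rmorphM rmorphXn tz tG expr0n (negPf Dm0).
    by rewrite !mul0r add0r dvdp_mull.
  rewrite Gauss_dvdpl => [/dvdpP[q ->]|]; first by rewrite coefMXn iN.
  rewrite coprimep_sym coprimep_expr // -['X]subr0 -polyC0 coprimep_XsubC /root.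
  suff -> : (theta b).[0] = b.@[vertex K (0 + 1)] by [].
  rewrite /= /mmap /meval /mmap horner_sum; apply: eq_bigr => u _.
  rewrite hornerM hornerC /mmap1 horner_prod; congr (_ * _); apply: eq_bigr => j _.
  rewrite horner_exp; congr (_ ^+ _); rewrite /infty_var /vertex.
  by elim/(ord3_cases (i := 0)): j; rewrite /= ?hornerX ?hornerC.
suff H a b : A`_b`_a != 0 ->
    bounded (ff_const X) x y D.-1 (ff_const X A`_b`_a * x ^+ a * y ^+ b).
  rewrite bievE; apply: bounded_sum => b _; apply: bounded_sum => a _.
  have [->|/H //] := eqVneq A`_b`_a 0.
  by rewrite rmorph0 !mul0r; exact: bounded0.
move=> A0; have abD := AD _ _ A0.
have [abD1|abD1] := leqP (a + b) D.-1; first exact: bounded_monomial.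
have {abD1} abE : (a + b)%N = D.
  by apply/eqP; rewrite eqn_leq abD -(prednK (leq_ltn_trans (leq0n _) mD)).
have bE : (D - a)%N = b by rewrite -abE addKn.
have na : (n <= a)%N.
  rewrite leqNgt; apply: contra A0 => /lead0; rewrite bE => -> //.
  by rewrite -abE leq_addr.
case: b bE A0 abE {abD} => [|b] bE A0 abE.
  by move: A0; rewrite -[a]addn0 abE AD0 eqxx.
have xyE := chart_eq (ff_chart X n_gt0 0).
(* Uses x^n y = -(y^n + x); the two new monomials have degrees D - 1 and D - n. *)
have -> : ff_const X A`_b.+1`_a * x ^+ a * y ^+ b.+1 =
  - (ff_const X A`_b.+1`_a * x ^+ (a - n) * y ^+ (b + n) +
     ff_const X A`_b.+1`_a * x ^+ (a - n).+1 * y ^+ b).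
  have -> : x ^+ a = x ^+ (a - n) * x ^+ n by rewrite -exprD subnK.
  rewrite [y ^+ b.+1]exprS [y ^+ (b + n)]exprD [x ^+ (a - n).+1]exprS.
  have xnyE : x ^+ n * y = - (y ^+ n + x).
    by apply/eqP; rewrite -addr_eq0 addrCA addrA xyE.
  have H k u v w t : k * (u * v) * (w * t) = k * u * t * (v * w) :> X by ring.
  by rewrite H xnyE; ring.
apply: boundedN; apply: boundedD; apply: bounded_monomial.
  by rewrite -abE addnS /= [(b + n)%N]addnC addnA subnK.
by rewrite -abE addnS /= leq_add2r ltn_subrL n_gt0 (leq_trans n_gt0).
Qed.

Lemma global_sections m (phi : X) :
  (forall (P : 'I_3 -> K) i, on_curve G P -> P (i + 1 + 1) != 0 ->
     regular_at P (phi / c (i + 1 + 1) ^+ m)) <->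
  exists2 f, bounded (ff_const X) x y m f & phi = f * c z ^+ m.
Proof.
have c0 l i : c i ^+ l != 0 by rewrite expf_neq0 ?(ff_coord_neq0 X n_gt0).
split=> [reg|[f [A [Am ->]] ->] P i PG Pz]; last first.
  have hH := hom_homog 0 Am.
  have HE := ff_mmap_dehom X n_gt0 0 hH.
  rewrite dehom_hom in HE.
  rewrite [ev A * _]mulrC -HE (ff_mmap_dehom X n_gt0 i hH) mulrAC divff // mul1r.
  apply/(regular_at_chart n_gt0 _ Pz); exists (dehom i (hom 0 m A)), 1.
  by rewrite /chart_at !rmorph1 oner_eq0 divr1.
have [A AE] : exists A, phi / c z ^+ m = ev A.
  apply: (chart_sections n_gt1 (ff_chart X n_gt0 0)) => a b hab.
  pose P (j : 'I_3) : K := if j == 0 then a else if j == 0 + 1 then b else 1.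
  have P1 : P z = 1 by [].
  have Pz : P z != 0 by rewrite P1 oner_eq0.
  have CE B : chart_at P 0 B = biev idfun a b B by rewrite /chart_at P1 !divr1.
  have PG : on_curve G P.
    split; first by exists z.
    rewrite -[LHS]/(mmap idfun P G) (mmap_dehom idfun Pz (hurwitz_homog K n)).
    by rewrite dehom_hurwitz -/(chart_at P 0 _) CE hab mulr0.
  have /(regular_at_chart n_gt0 _ Pz)[B [C [C0 ->]]] := reg P 0 PG Pz.
  by exists B, C; rewrite -CE.
have phiE : phi = c z ^+ m * ev A by rewrite -AE mulrC divfK.
(* Descent on the excess k of the degree over m; the representative changes at each step, so B is
   quantified. *)
suff H k B : phi = c z ^+ m * ev B -> tdeg_le (m + k) B ->
    bounded (ff_const X) x y m (ev B).
  exists (ev A); last by rewrite mulrC.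
  have [k Ak] := tdeg_le_exists A.
  by apply: (H k) => //; apply: tdeg_leW Ak; exact: leq_addl.
elim: k B => [|k IHk] B phiB; first by rewrite addn0 => Bm; exists B.
rewrite addnS => Bm.
have [|j|C [Ck CE]] := infty_step Bm (m := m); first by rewrite ltnS leq_addr.
  rewrite -phiB; have [_ _ _ jE] := ord3_neq j; rewrite -jE.
  by apply: reg; [exact: on_curve_vertex|rewrite jE /vertex eqxx oner_eq0].
by rewrite CE; apply: IHk => //; rewrite -CE.
Qed.

End GlobalSections.

(** * The kernel of the Cartier operator *)

Section Dimension.
Variables (K F : fieldType) (iota : {rmorphism K -> F}) (M : lmodType F).

(** Expressing each family in the other gives matrices f and g, and freeness of b forces f g = 1,
    which bounds m by l. *)
Lemma has_dim_leq (S : classical_sets.set M) m l :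
  has_dim iota S m -> has_dim iota S l -> (m <= l)%N.
Proof.
move=> [b [bfree bS]] [b' [_ bS']].
have bin i : S (b i).
  apply/bS; exists (fun j => (j == i)%:R).
  rewrite (bigD1 i) //= eqxx rmorph1 scale1r big1 ?addr0 // => j /negPf ->.
  by rewrite rmorph0 scale0r.
have bin' i : S (b' i).
  apply/bS'; exists (fun j => (j == i)%:R).
  rewrite (bigD1 i) //= eqxx rmorph1 scale1r big1 ?addr0 // => j /negPf ->.
  by rewrite rmorph0 scale0r.
have /choice[f fE] i := (bS' (b i)).1 (bin i).
have /choice[g gE] i := (bS (b' i)).1 (bin' i).
apply: (mulmx1_min (A := \matrix_(i, j) f i j) (B := \matrix_(i, j) g i j)).
apply/matrixP => i k; rewrite !mxE; apply/eqP; rewrite -subr_eq0; apply/eqP.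
under eq_bigr => j _ do rewrite !mxE.
apply: (bfree (fun k => \sum_j f i j * g j k - (i == k)%:R)).
under eq_bigr => j _ do rewrite rmorphB scalerBl.
rewrite sumrB [X in _ - X](bigD1 i) //= eqxx rmorph1 scale1r.
rewrite [X in _ - (_ + X)]big1 => [|j /negPf ji]; last first.
  by rewrite eq_sym ji rmorph0 scale0r.
rewrite addr0; apply/eqP; rewrite subr_eq0; apply/eqP.
rewrite [RHS]fE; under [RHS]eq_bigr => j _ do rewrite gE scaler_sumr.
rewrite exchange_big /=; apply: eq_bigr => j _.
rewrite rmorph_sum scaler_suml; apply: eq_bigr => l' _.
by rewrite rmorphM scalerA.
Qed.

Lemma dimK_eq (S : classical_sets.set M) m : has_dim iota S m -> dimK iota S = m.
Proof.
move=> Sm; apply: classical_sets.xget_unique => // l Sl.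
by apply/eqP; rewrite eqn_leq !(has_dim_leq (S := S)).
Qed.

End Dimension.

Section MonomialSums.
Variables (K : fieldType) (I : finType) (P : pred I) (e : I -> nat * nat).

Definition monomial_sum (c : I -> K) : {poly {poly K}} :=
  \sum_(t | P t) (c t *: 'X ^+ (e t).1)%:P * 'X ^+ (e t).2.

Lemma coef_monomial_sum c a b :
  (monomial_sum c)`_b`_a = \sum_(t | P t && (e t == (a, b))) c t.
Proof.
rewrite /monomial_sum coef_sum coef_sum big_mkcondr /=; apply: eq_bigr => t _.
rewrite coefCM coefXn mulr_natr mulrb; case: (e t) => a' b' /=.
rewrite xpair_eqE andbC eq_sym; case: eqP; rewrite ?coef0 // => _.
by rewrite coefZ coefXn mulr_natr mulrb eq_sym.
Qed.

Lemma biev_monomial_sum (L : fieldType) (kappa : {rmorphism K -> L}) x y c :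
  biev kappa x y (monomial_sum c) =
  \sum_(t | P t) kappa (c t) * (x ^+ (e t).1 * y ^+ (e t).2).
Proof.
rewrite rmorph_sum; apply: eq_bigr => t _.
rewrite -mul_polyC polyCM rmorphXn /= !rmorphM /= !rmorphXn /=.
by rewrite bievCC bievCX bievX mulrA.
Qed.

(** Exponents of y below n keep the polynomial too short to be a non-zero multiple of the
    equation. *)
Lemma monomials_free (L : fieldType) n (kappa : {rmorphism K -> L}) x y c :
  (1 < n)%N -> chart n kappa x y ->
  {in P &, injective e} -> (forall t, P t -> ((e t).1 + (e t).2 < n)%N) ->
  \sum_(t | P t) kappa (c t) * (x ^+ (e t).1 * y ^+ (e t).2) = 0 ->
  forall t, P t -> c t = 0.
Proof.
move=> n1 xy inje en; rewrite -biev_monomial_sum => H t Pt.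
have A0 : monomial_sum c = 0.
  apply: (biev_eq0_size n1 xy H); apply: (leq_trans (size_sum _ _ _)).
  apply/bigmax_leqP => u Pu; apply: (leq_trans (size_polyMleq _ _)).
  rewrite size_polyXn addnS /=.
  apply: (@leq_trans (1 + (e u).2)); first by rewrite leq_add2r size_polyC_leq1.
  by rewrite add1n (leq_ltn_trans (leq_addl _ _) (en u Pu)).
have := coef_monomial_sum c (e t).1 (e t).2; rewrite A0 !coef0 => /esym.
rewrite (bigD1 t) /=; last by rewrite Pt -surjective_pairing eqxx.
rewrite big1 ?addr0 // => u /andP[/andP[Pu eu] ut].
case/eqP: ut; apply: inje => //; by rewrite (eqP eu) -surjective_pairing.
Qed.

End MonomialSums.

(** * The Cartier operator on monomials *)

Section Cartier.
Variables (K : closedFieldType) (p s : nat).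
Hypotheses (hp : p \in [pchar K]) (s_gt0 : (0 < s)%N).
Variables (X : function_field (hurwitz K (s * p))) (W : differentials (ff_const X)).

Local Notation n := (s * p)%N.
Local Notation c := (ff_coord X).
Local Notation x := (xc X 0).
Local Notation y := (yc X 0).
Local Notation kap := (ff_const X).
Local Notation d := (diff W).

Let p_gt0 : (0 < p)%N. Proof. exact: prime_gt0 (pcharf_prime hp). Qed.

Let n_gt1 : (1 < n)%N.
Proof. exact: leq_trans (prime_gt1 (pcharf_prime hp)) (leq_pmull _ s_gt0). Qed.

Let n_gt0 : (0 < n)%N. Proof. exact: ltnW. Qed.

Let hpX : p \in [pchar X]. Proof. by rewrite (fmorph_pchar (ff_const X)). Qed.

Let xy : chart n kap x y. Proof. exact: ff_chart. Qed.

Let pbasis := chart_pbasis hp xy.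

Lemma holomorphic_bounded (w : W) : holomorphic w <->
  exists2 f, bounded kap x y (n - 2) f & w = f *: d y.
Proof.
rewrite (holomorphicP hp s_gt0).
have z0 : c (0 + 1 + 1) ^+ (n - 2) != 0.
  by rewrite expf_neq0 ?(ff_coord_neq0 X n_gt0).
split=> [[phi /(global_sections n_gt1 _ _) [f fb ->] ->]|[f fb ->]].
  by exists f; rewrite // /eta scalerA mulfK.
exists (f * c (0 + 1 + 1) ^+ (n - 2)); last by rewrite /eta scalerA mulfK.
by apply/(global_sections n_gt1 _ _); exists f.
Qed.

Variable D : X -> X.
Hypotheses (dD : derivative (D : X -> X^o)) (Dy : D y = 1).

Let dE f : d f = D f *: d y. Proof. exact: (diff_chart hp s_gt0 W (i := 0)). Qed.

(** [xget] picks some separating u and some expression of f dy in u; [iterDp1_rep] gives the same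
    criterion for every choice. *)
Lemma cartier_eq0 f : cartier p (f *: d y) = 0 <-> iter p.-1 D f = 0.
Proof.
rewrite /cartier; set S := (X in classical_sets.xget 0 X).
have dy0 := diff_yc_neq0 hp s_gt0 W 0.
have Dsep u : separating p u -> D u != 0.
  by move=> us; apply/eqP => /(D_eq0 hpX pbasis dD Dy).
(* The default value 0 is not what is returned: y is separating, since D y = 1, and the p-basis
   gives an expression. *)
have [u [v [us wE ->]]] : S (classical_sets.xget 0 S).
  apply: classical_sets.xgetPex; have [u uE] := pbasis f.
  exists (u p.-1 *: d y), y, u; split; rewrite -?uE // => -[z yz].
  by have /eqP := Dy; rewrite yz (derivative_pth dD hpX) eq_sym oner_eq0.
have fE : f = (\sum_(i < p) v i ^+ p * u ^+ i) * D u.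
  move: wE; rewrite (dE u) scalerA => /eqP; rewrite -subr_eq0 -scalerBl scaler_eq0.
  by rewrite (negPf dy0) orbF subr_eq0 => /eqP.
rewrite fE (iterDp1_rep hpX pbasis dD Dy v (Dsep u us)); split=> [/eqP|->].
  rewrite (dE u) scalerA scaler_eq0 (negPf dy0) orbF mulf_eq0.
  by rewrite (negPf (Dsep u us)) orbF => /eqP.
by rewrite scale0r.
Qed.

(** For k from p to 2p - 2 the factor y^p comes out as a constant and leaves an exponent below p -
    1. *)
Lemma iterDp1_pow k : (k <= p.-1 + p.-1)%N ->
  iter p.-1 D (y ^+ k) = if k == p.-1 then (p.-1)`!%:R else 0.
Proof.
move=> kp; case: eqP => [->|kp1].
  by rewrite (iter_derivative_X dD _ _ Dy) subnn expr0 ffactnn.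
have [kp2|kp2] := ltnP k p.-1.
  by rewrite (iter_derivative_X dD _ _ Dy) ffact_small // mulr0n.
have pk : (p <= k)%N.
  by rewrite -(prednK p_gt0) ltn_neqAle kp2 andbT; apply/eqP => E; apply: kp1.
rewrite -(subnKC pk) exprD (iter_derivative_pthM dD hpX).
rewrite (iter_derivative_X dD _ _ Dy) ffact_small ?mulr0n ?mulr0 //.
by rewrite ltn_subLR // (leq_ltn_trans kp) // ltn_add2r prednK.
Qed.

(* As x = -(x^n y + y^n), the monomial x^i y^j is a combination of the
   y^(k+j), k <= i, with p-th powers as coefficients; d^(p-1)/dy^(p-1) only
   sees k + j = p - 1. *)
Lemma iterDp1_monomial i j : (i < p)%N -> (j < p)%N ->
  iter p.-1 D (x ^+ i * y ^+ j) =
  if (p.-1 <= i + j)%N then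
    kap ((-1) ^+ i * ((p.-1)`! * 'C(i, p.-1 - j))%:R) *
    (x ^+ (s * (p.-1 - j)) * y ^+ (s * (i + j - p.-1))) ^+ p
  else 0.
Proof.
move=> ip jp.
have xE : x = - (y ^+ n + x ^+ n * y).
  by apply/eqP; rewrite -addr_eq0 addrC (chart_eq xy).
have -> : x ^+ i = (-1) ^+ i * (y ^+ n + x ^+ n * y) ^+ i
  by rewrite -exprMn mulN1r -xE.
rewrite -mulrA (iter_derivativeMconst dD); last first.
  rewrite (derivativeX dD) (derivativeN dD) (derivative1 dD) oppr0.
  exact: mulr0.
rewrite exprDn mulr_suml (iter_derivative_sum dD).
have tE (k : 'I_i.+1) : iter p.-1 D
    ((y ^+ n) ^+ (i - k) * (x ^+ n * y) ^+ k *+ 'C(i, k) * y ^+ j) =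
    (y ^+ (s * (i - k)) * x ^+ (s * k)) ^+ p *
    (if (k + j)%N == p.-1 then ((p.-1)`! * 'C(i, k))%N else 0%N)%:R.
  have aux (u v : X) :
      (v ^+ n) ^+ (i - k) * (u ^+ n * v) ^+ k *+ 'C(i, k) * v ^+ j =
      (v ^+ (s * (i - k)) * u ^+ (s * k)) ^+ p * ('C(i, k)%:R * v ^+ (k + j)).
    rewrite !exprMn -!exprM exprD -mulr_natr [(s * _ * p)%N]mulnAC.
    by rewrite [(s * k * p)%N]mulnAC; ring.
  rewrite {}aux.
  rewrite (iter_derivative_pthM dD hpX) (iter_derivativeMconst dD);
    last exact: (derivative_natr dD).
  rewrite iterDp1_pow.
    by congr (_ * _); case: eqP => _; rewrite ?mulr0 // natrM mulrC.
  by apply: leq_add; rewrite -ltnS prednK //; exact: leq_trans (ltn_ord k) ip.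
under eq_bigr => k _ do rewrite tE.
case: leqP => ij.
  have pj : (j <= p.-1)%N by rewrite -ltnS prednK.
  have ki : (p.-1 - j < i.+1)%N by rewrite ltnS leq_subLR addnC.
  rewrite (bigD1 (Ordinal ki)) //= big1 ?addr0 => [|k kn].
    rewrite subnK // eqxx [kap _]rmorphM rmorphXn rmorphN rmorph1 rmorph_nat.
    have -> : (i - (p.-1 - j) = i + j - p.-1)%N by rewrite subnBA.
    by rewrite [y ^+ _ * _]mulrC mulrA mulrAC.
  case: eqP => [kj|_]; last by rewrite mulr0.
  by case/eqP: kn; apply: val_inj; rewrite /= -kj addnK.
rewrite big1 ?mulr0 // => k _; case: eqP => [kj|_]; last by rewrite mulr0.
by move: ij; rewrite -kj ltn_add2r ltnNge -ltnS ltn_ord.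
Qed.

End Cartier.

(** Row i has l - i points, with truncated subtraction; the factor 2 avoids a division. *)
Lemma card_triangle k l : (l <= k)%N ->
  (2 * #|[set t : 'I_k * 'I_k | (t.1 + t.2 < l)%N]| = l * l.+1)%N.
Proof.
move=> lk.
have -> : #|[set t : 'I_k * 'I_k | (t.1 + t.2 < l)%N]| = (\sum_(i < k) (l - i))%N.
  rewrite -sum1dep_card -(pair_big_dep predT
    (fun i j : 'I_k => (i + j < l)%N) (fun _ _ => 1%N)) /=.
  apply: eq_bigr => i _; under eq_bigl => j do rewrite -ltn_subRL.
  rewrite -(big_ord_widen _ (fun=> 1%N)) ?sum1_card ?card_ord //.
  exact: leq_trans (leq_subr _ _) lk.
elim: k l lk => [|k IHk] l lk.
  by move: lk; rewrite leqn0 => /eqP ->; rewrite big_ord0.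
rewrite big_ord_recl subn0.
case: l lk => [|l] lk; first by rewrite big1 // => i _; rewrite sub0n.
under eq_bigr => i _ do rewrite /= /bump add1n subSS.
by rewrite mulnDr IHk //; ring.
Qed.

Lemma euclid_inj q : {in [pred r : nat * nat | (r.2 < q)%N] &,
  injective (fun r : nat * nat => (q * r.1 + r.2)%N)}.
Proof.
move=> [a b] [a' b']; rewrite !inE /= => bq bq' E.
have q0 : (0 < q)%N by apply: leq_ltn_trans bq.
have := congr1 (divn^~ q) E; rewrite /= ![(q * _)%N]mulnC !divnMDl //.
rewrite !divn_small // !addn0 => aE.
by move: E; rewrite aE => /addnI ->.
Qed.

(** * The monomial basis of the kernel and its size *)

Section Main.
Variables (K : closedFieldType) (p s : nat).
Hypotheses (hp : p \in [pchar K]) (s_gt0 : (0 < s)%N).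

Local Notation n := (s * p)%N.

(* The exponents of x^i y^j, split by i = p i1 + i0 and j = p j1 + j0, are
   indexed by t = ((i1, j1), (i0, j0)). *)
Local Notation I := (('I_s * 'I_s) * ('I_p * 'I_p))%type.
Implicit Types t : I.

Let p_gt0 : (0 < p)%N. Proof. exact: prime_gt0 (pcharf_prime hp). Qed.

Let n_gt1 : (1 < n)%N.
Proof. exact: leq_trans (prime_gt1 (pcharf_prime hp)) (leq_pmull _ s_gt0). Qed.

Definition expo t : nat * nat :=
  ((p * t.1.1 + t.2.1)%N, (p * t.1.2 + t.2.2)%N).

(** When t [carries], these are the exponents of the monomial in C(x^i y^j dy), that is, of the p-th
    root of the (p-1)-st derivative of x^i y^j up to a constant. *)
Definition cexpo t : nat * nat :=
  ((s * (p.-1 - t.2.2) + t.1.1)%N, (s * (t.2.1 + t.2.2 - p.-1) + t.1.2)%N).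

Definition in_range t := ((expo t).1 + (expo t).2 <= n - 2)%N.
(** The criterion for the Cartier operator not to kill the monomial. *)
Definition carries t := (p.-1 <= t.2.1 + t.2.2)%N.

Lemma expo_inj : injective expo.
Proof.
move=> [[i1 j1] [i0 j0]] [[i1' j1'] [i0' j0']] [E1 E2].
have [/val_inj -> /val_inj ->] := @euclid_inj p (i1 : nat, i0 : nat)
  (i1' : nat, i0' : nat) (ltn_ord i0) (ltn_ord i0') E1.
by have [/val_inj -> /val_inj ->] := @euclid_inj p (j1 : nat, j0 : nat)
  (j1' : nat, j0' : nat) (ltn_ord j0) (ltn_ord j0') E2.
Qed.

(** Division by s recovers i1, j1, p - 1 - j0 and i0 + j0 - (p - 1); [carries] makes the last
    truncated difference a true one. *)
Lemma cexpo_inj : {in [pred t | carries t] &, injective cexpo}.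
Proof.
move=> [[i1 j1] [i0 j0]] [[i1' j1'] [i0' j0']]; rewrite !inE /carries /=.
move=> c1 c2 [E1 E2].
have [E4 /val_inj ->] := @euclid_inj s (p.-1 - j0, i1 : nat)%N
  (p.-1 - j0', i1' : nat)%N (ltn_ord i1) (ltn_ord i1') E1.
have [E3 /val_inj ->] := @euclid_inj s (i0 + j0 - p.-1, j1 : nat)%N
  (i0' + j0' - p.-1, j1' : nat)%N (ltn_ord j1) (ltn_ord j1') E2.
have lep (k : 'I_p) : (k <= p.-1)%N by rewrite -ltnS prednK.
have jE : j0 = j0'.
  by apply/val_inj; rewrite /= -[LHS](subKn (lep j0)) E4 subKn.
have iE : i0 = i0'.
  by apply/val_inj/(@addIn j0); rewrite /= -(subnK c1) E3 jE subnK.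
by rewrite jE iE.
Qed.

(** The two exponents add up to s i0 + i1 + j1, where i0 < p and i1 + j1 < s. The bound is the one
    that [monomials_free] asks for. *)
Lemma cexpo_range t : in_range t -> carries t ->
  ((cexpo t).1 + (cexpo t).2 < n)%N.
Proof.
case: t => [[i1 j1] [i0 j0]]; rewrite /in_range /carries /expo /cexpo /= => H c.
have lep (k : 'I_p) : (k <= p.-1)%N by rewrite -ltnS prednK.
have -> : (s * (p.-1 - j0) + i1 + (s * (i0 + j0 - p.-1) + j1) =
    s * i0 + (i1 + j1))%N.
  rewrite addnACA -mulnDr; congr (s * _ + _)%N.
  by rewrite addnC addnBA ?lep // subnK // addnK.
have ij : (i1 + j1 < s)%N.
  rewrite -(ltn_pmul2l p_gt0) [(p * s)%N]mulnC.
  apply: leq_ltn_trans (_ : _ <= n - 2)%N _.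
    by apply: leq_trans H; rewrite addnACA -mulnDr leq_addr.
  by rewrite ltn_subrL (ltnW n_gt1).
apply: (@leq_trans (s * i0 + s)); first by rewrite ltn_add2l.
by rewrite -mulnSr leq_mul2l ltn_ord orbT.
Qed.

Definition kernel_set : {set I} := [set t | in_range t && ~~ carries t].

(** Once i0 + j0 <= p - 2, the bound p (i1 + j1) + i0 + j0 <= sp - 2 amounts to i1 + j1 < s, so
    quotients and remainders decouple. *)
Lemma kernel_setE : kernel_set =
  setX [set u : 'I_s * 'I_s | (u.1 + u.2 < s)%N]
       [set v : 'I_p * 'I_p | (v.1 + v.2 < p.-1)%N].
Proof.
apply/setP => -[[i1 j1] [i0 j0]]; rewrite !inE /in_range /carries /expo /= -ltnNge.
rewrite andbC [RHS]andbC; case: ltnP => //= ij0.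
rewrite addnACA -mulnDr; move: (i1 + j1)%N (i0 + j0)%N ij0 => a b bp.
have p1 := prime_gt1 (pcharf_prime hp).
have bp' : (b + 2 <= p)%N by rewrite addn2 -(prednK p_gt0) ltnS.
rewrite -(leq_add2r 2) subnK // [n]mulnC; apply/idP/idP => H.
  rewrite -(ltn_pmul2l p_gt0); apply: leq_trans H.
  by rewrite -addnA addn2 addnS ltnS leq_addr.
apply: leq_trans (_ : p * a.+1 <= _)%N; last by rewrite leq_mul2l H orbT.
by rewrite mulnSr -addnA leq_add2l.
Qed.

Lemma card_kernel_set : (4 * #|kernel_set| = s * s.+1 * (p.-1 * p))%N.
Proof.
rewrite kernel_setE cardsX -[4%N]/(2 * 2)%N mulnACA card_triangle //.
by rewrite card_triangle ?leq_pred // prednK.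
Qed.

Variables (X : function_field (hurwitz K n)) (W : differentials (ff_const X)).

Local Notation x := (xc X 0).
Local Notation y := (yc X 0).
Local Notation kap := (ff_const X).
Local Notation d := (diff W).
Local Notation mono t := (x ^+ (expo t).1 * y ^+ (expo t).2).

Let hpX : p \in [pchar X]. Proof. by rewrite (fmorph_pchar (ff_const X)). Qed.

Let xy : chart n kap x y. Proof. exact/ff_chart/ltnW. Qed.

Lemma bounded_expo f : bounded kap x y (n - 2) f <->
  exists g : I -> K, f = \sum_(t | in_range t) kap (g t) * mono t.
Proof.
split=> [[A [An ->]]|[g ->]]; last first.
  by apply: bounded_sum => t tr; rewrite mulrA; exact: bounded_monomial.
exists (fun t => A`_(expo t).2`_(expo t).1); rewrite -biev_monomial_sum.
congr (biev _ _ _ _); apply/polyP => b; apply/polyP => a.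
rewrite coef_monomial_sum.
have [abn|abn] := leqP (a + b) (n - 2); last first.
  rewrite big1 => [|t /andP[tr /eqP et]].
    by apply/eqP; apply: contraTT abn => /An; rewrite -leqNgt.
  by move: tr; rewrite /in_range et leqNgt abn.
have lts k : (k <= n - 2)%N -> (k %/ p < s)%N.
  by move=> kn; rewrite ltn_divLR // (leq_ltn_trans kn) // ltn_subrL (ltnW n_gt1).
(* The index comes from dividing both exponents by p; a + b <= n - 2 keeps the quotients below s. *)
pose t : I := ((Ordinal (lts a (leq_trans (leq_addr b a) abn)),
  Ordinal (lts b (leq_trans (leq_addl a b) abn))),
  (Ordinal (ltn_pmod a p_gt0), Ordinal (ltn_pmod b p_gt0))).
have et : expo t = (a, b) by rewrite /expo /= ![(p * _)%N]mulnC -!divn_eq.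
rewrite (bigD1 t); last by rewrite /in_range et abn eqxx.
rewrite et big1 => [|u /andP[/andP[_ /eqP eu] /eqP]]; first by rewrite /= addr0.
by case; apply: expo_inj; rewrite et.
Qed.

(** The constant g and the part of the monomial with exponents p i1, p j1 are p-th powers and come
    out of the derivative. *)
Lemma iterDp1_expo (D : X -> X) g t : derivative (D : X -> X^o) -> D y = 1 ->
  iter p.-1 D (kap g * mono t) =
  if carries t then
    kap (g * ((-1) ^+ t.2.1 * ((p.-1)`! * 'C(t.2.1, p.-1 - t.2.2))%:R)) *
    (x ^+ (cexpo t).1 * y ^+ (cexpo t).2) ^+ p
  else 0.
Proof.
move=> dD Dy; have [z ->] := closed_pth_root g p_gt0.
have -> : kap (z ^+ p) * mono t = (kap z * (x ^+ t.1.1 * y ^+ t.1.2)) ^+ p *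
    (x ^+ t.2.1 * y ^+ t.2.2).
  have aux (k u v : X) a b a' b' :
      k ^+ p * (u ^+ (p * a + b) * v ^+ (p * a' + b')) =
      (k * (u ^+ a * v ^+ a')) ^+ p * (u ^+ b * v ^+ b').
    by rewrite !exprD ![(p * _)%N]mulnC !exprM !exprMn; ring.
  by rewrite rmorphXn aux.
rewrite (iter_derivative_pthM dD hpX) (iterDp1_monomial hp s_gt0 dD Dy) //.
rewrite /carries; case: ifP => _; last by rewrite mulr0.
have aux (u v w k : X) a b a' b' :
    (w * (u ^+ b * v ^+ b')) ^+ p * (k * (u ^+ a * v ^+ a') ^+ p) =
    w ^+ p * k * (u ^+ (a + b) * v ^+ (a' + b')) ^+ p.
  by rewrite !exprD !exprMn; ring.
by rewrite aux; congr (_ * _); rewrite [RHS]rmorphM rmorphXn.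
Qed.

Lemma pth_power_sum (P : pred I) (g : I -> X) :
  \sum_(t | P t) g t ^+ p = (\sum_(t | P t) g t) ^+ p.
Proof. by rewrite -[RHS]/(pFrobenius_aut hpX _) rmorph_sum. Qed.

(** The derivative is the p-th power of a combination of the monomials with exponents [cexpo], which
    are distinct and independent for the t that carry. *)
Lemma kernel_iff (D : X -> X) (g : I -> K) :
  derivative (D : X -> X^o) -> D y = 1 ->
  iter p.-1 D (\sum_(t | in_range t) kap (g t) * mono t) = 0 <->
  forall t, in_range t -> carries t -> g t = 0.
Proof.
move=> dD Dy; rewrite (iter_derivative_sum dD).
under eq_bigr => t _ do rewrite iterDp1_expo //.
rewrite -big_mkcondr /=; split=> [H|H]; last first.
  by rewrite big1 // => t /andP[tr tc]; rewrite H // mul0r rmorph0 mul0r.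
set eps := fun t : I =>
  (-1) ^+ t.2.1 * ((p.-1)`! * 'C(t.2.1, p.-1 - t.2.2))%:R : K.
(* The carry gives p - 1 - j0 <= i0, so the binomial coefficient divides i0!, which is non-zero
   modulo p because i0 < p. *)
have eps0 t : carries t -> eps t != 0.
  rewrite /carries => tc; rewrite mulf_neq0 ?signr_eq0 //.
  rewrite natrM mulf_neq0 ?(fact_neq0 hp) ?prednK //.
  have tp : (p.-1 - t.2.2 <= t.2.1)%N by rewrite leq_subLR addnC.
  have := fact_neq0 hp (ltn_ord t.2.1).
  by rewrite -(bin_fact tp) natrM mulf_eq0 negb_or => /andP[].
(* With p-th roots of the coefficients the whole sum becomes a p-th power, and the root can be
   taken. *)
have /choice[del delE] t : exists z, g t * eps t = z ^+ p.
  exact: closed_pth_root.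
have {}H : \sum_(t | in_range t && carries t)
    kap (del t) * (x ^+ (cexpo t).1 * y ^+ (cexpo t).2) = 0.
  set S := (LHS); suff /eqP : S ^+ p = 0 by rewrite expf_eq0 p_gt0 => /eqP.
  rewrite -pth_power_sum -[RHS]H; apply: eq_bigr => t _.
  by rewrite -/(eps t) delE [kap (del t ^+ p)]rmorphXn exprMn.
move=> t tr tc.
have dt0 : del t = 0.
  apply: (monomials_free n_gt1 xy _ _ H); last by rewrite tr.
    by move=> u v /andP[_ uc] /andP[_ vc]; exact: cexpo_inj.
  by move=> u /andP[]; exact: cexpo_range.
have /eqP := delE t; rewrite dt0 expr0n gtn_eqF //= mulf_eq0.
by rewrite (negPf (eps0 t tc)) orbF => /eqP.
Qed.

Lemma kernel_has_dim : has_dim kap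
  (fun w : W => holomorphic w /\ cartier p w = 0) #|kernel_set|.
Proof.
have n0 : n%:R = 0 :> K by rewrite natrM (pcharf0 hp) mulr0.
have [D [dD Dy _]] := chart_derivation xy n0.
have sumE (h : I -> X) :
    \sum_(t in kernel_set) h t = \sum_(i < #|kernel_set|) h (enum_val i).
  exact: big_enum_val.
have inE t : (t \in kernel_set) = in_range t && ~~ carries t by rewrite inE.
exists (fun i => mono (enum_val i) *: d y); split=> [g|w].
  under eq_bigr => i _ do rewrite scalerA.
  rewrite -scaler_suml => /eqP.
  rewrite scaler_eq0 (negPf (diff_yc_neq0 hp s_gt0 W 0)) orbF => /eqP H i.
  apply: (monomials_free (P := predT) (e := fun i => expo (enum_val i))
    n_gt1 xy) => //.
    by move=> u v _ _ /expo_inj/enum_val_inj.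
  move=> u _; have := enum_valP u; rewrite inE => /andP[ur _].
  by apply: leq_ltn_trans ur _; rewrite ltn_subrL (ltnW n_gt1).
split=> [[/(holomorphic_bounded hp s_gt0)[f /bounded_expo[g ->] ->]]|[g ->]].
  move=> /(cartier_eq0 hp s_gt0 W dD Dy)/(kernel_iff _ dD Dy) g0.
  exists (fun i => g (enum_val i)).
  under [RHS]eq_bigr => i _ do rewrite scalerA.
  rewrite -scaler_suml; congr (_ *: _).
  rewrite -(sumE (fun t => kap (g t) * mono t)).
  rewrite (bigID carries) /= big1 ?add0r => [|t /andP[tr tc]]; last first.
    by rewrite g0 // rmorph0 mul0r.
  by apply: eq_bigl => t; rewrite inE.
(* The coefficients transported from the enumeration to all of [I]; they are 0 outside [kernel_set],
   the sum being empty there. *)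
pose g' t := \sum_(i | enum_val i == t) g i.
have gE (h : I -> X) : \sum_i kap (g i) * h (enum_val i) =
    \sum_(t | in_range t) kap (g' t) * h t.
  rewrite (partition_big enum_val in_range) => [|i _]; last first.
    by have := enum_valP i; rewrite inE => /andP[].
  apply: eq_bigr => t _; rewrite rmorph_sum mulr_suml.
  by apply: eq_bigr => i /eqP ->.
under eq_bigr => i _ do rewrite scalerA.
rewrite -scaler_suml (gE (fun t => mono t)); split.
  apply/(holomorphic_bounded hp s_gt0); eexists; last by [].
  by apply/bounded_expo; exists g'.
apply/(cartier_eq0 hp s_gt0 W dD Dy)/(kernel_iff _ dD Dy) => t tr tc.
rewrite /g' big1 // => i /eqP it; have := enum_valP i.
by rewrite it inE tc andbF.
Qed.

End Main.

Theorem theorem4p3 (K : closedFieldType) (p : nat) (hp : p \in [pchar K])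
  (s : nat) (hs : (1 <= s)%N)
  (X : function_field (hurwitz K (s * p))) (W : differentials (ff_const X)) :
  (a_number W p)%:R
    = 1 / 4%:R * s%:R * (s%:R + 1) * p%:R * (p%:R - 1) :> rat.
Proof.
have p0 := prime_gt0 (pcharf_prime hp).
have -> : a_number W p = #|kernel_set p s|.
  exact: dimK_eq (kernel_has_dim hp hs W).
have := congr1 (fun k => k%:R : rat) (card_kernel_set hp hs).
have -> : p%:R - 1 = p.-1%:R :> rat by rewrite -{1}(prednK p0) -natr1 addrK.
rewrite /= !natrM -(natr1 s) => H.
by apply: (mulfI (_ : 4%:R != 0)); rewrite // H; field.
Qed.
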